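(* Let $g_k(z)=\sum_{n\ge1}\beta_k(n)q^n$ (for odd $k\ge 3$) be as in the context, and let $D(n)=\sum_{j=0}^{n}\binom{n}{j}^3$. Then for any prime $p>2$ and integer $r\ge 1$, $$(-1)^{\frac{p^r-1}{2}} D\left(\frac{p^r-1}{2}\right) \equiv \beta_{2r+1}(p) \pmod{p}.$$
   Context: For each odd integer $k\ge 3$, $g_k(z)=\sum_{n\ge1}\beta_k(n)q^n\in S_k(\Gamma_0(8),(\tfrac{-8}{\cdot}))$ is a weight $k$ newform with complex multiplication by $\mathbb{Q}(\sqrt{-2})$ whose coefficients at primes $p$ are: $\beta_k(p)=(c+d\sqrt{-2})^{k-1}+(c-d\sqrt{-2})^{k-1}$ if $p\equiv 1,3\pmod 8$, where $p=c^2+2d^2$ with integers $c,d$; $\beta_k(2)=(-2)^{(k-1)/2}$; and $\beta_k(p)=0$ otherwise. *)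

(* Defs.v *)
From mathcomp Require Import all_boot all_order all_algebra complex.
From mathcomp Require Import all_classical all_reals all_analysis.
Set Implicit Arguments.
Unset Strict Implicit.
Unset Printing Implicit Defensive.
Import Order.TTheory GRing.Theory Num.Theory.
Import numFieldNormedType.Exports.
Local Open Scope classical_set_scope.
Local Open Scope ring_scope.
Local Open Scope complex_scope.

Definition franel (n : nat) : nat := (\sum_(j < n.+1) 'C(n, j) ^ 3)%N.

(* The Kronecker symbol (-8/d), a function of d mod 8; it is also the quadratic
   character attached to Q(sqrt(-2)), whose discriminant is -8. *)
Definition kronecker_m8 (d : int) : int :=
  if ((d %% 8)%Z == 1) || ((d %% 8)%Z == 3) then 1
  else if ((d %% 8)%Z == 5) || ((d %% 8)%Z == 7) then -1
  else 0.

(* chi, a character mod N, does not factor through any (Z/M)^* with M a proper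
   divisor of N. *)
Definition primitive_mod (N : nat) (chi : int -> int) : Prop :=
  forall M : nat, (M %| N)%N -> (M < N)%N ->
    exists a b : int, [/\ coprimez a N, coprimez b N,
      (a = b %[mod M])%Z & chi a <> chi b].

Lemma kronecker_m8_primitive : primitive_mod 8 kronecker_m8.
Proof.
move=> M dM ltM; exists 1, 5; split=> //.
have dM4 : (M %| 4)%N.
  by case: M dM ltM => [|[|[|[|[|[|[|[|M]]]]]]]].
apply/eqP; rewrite eqz_mod_dvd; exact: dM4.
Qed.

Section ModularForms.
Variable R : realType.
Local Notation C := (R[i]).

Definition upper (z : C) : Prop := 0 < complex.Im z.

(* e^(2 pi i z) *)
Definition qexp (z : C) : C :=
  (expR (- (2 * pi * complex.Im z)))%:C *
  (cos (2 * pi * complex.Re z) +i* sin (2 * pi * complex.Re z)).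

Definition automorphy (c d : int) (z : C) : C := c%:~R * z + d%:~R.

Definition mobius (a b c d : int) (z : C) : C :=
  (a%:~R * z + b%:~R) / automorphy c d z.

(* C^o is C as a one-dimensional normed space over itself, so that derivable in
   the direction 1 is complex differentiability. *)
Definition holomorphic_upper (f : C -> C) : Prop :=
  forall z, upper z -> derivable (f : C^o -> C^o) z 1.

(* f lies in S_k(Gamma_0(N), chi), for chi a real character. Vanishing at every
   cusp is stated as: (c z + d)^(-k) f((a z + b)/(c z + d)) tends to 0 as Im z
   tends to infinity, for every matrix in SL_2(Z). *)
Record cusp_form (N k : nat) (chi : int -> int) (f : C -> C) : Prop := {
  cusp_form_holo : holomorphic_upper f;
  cusp_form_modular : forall (a b c d : int) (z : C),
    a * d - b * c = 1 -> (N %| c)%Z -> upper z ->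
    f (mobius a b c d z) = (chi d)%:~R * automorphy c d z ^+ k * f z;
  cusp_form_cusps : forall (a b c d : int), a * d - b * c = 1 ->
    forall e : R, 0 < e -> exists Y : R, forall z : C,
      upper z -> Y < complex.Im z ->
      `|automorphy c d z ^- k * f (mobius a b c d z)| < e%:C
}.

(* f = sum_(n >= 1) a_n q^n on the upper half-plane; a_0 plays no role. *)
Definition q_expansion (f : C -> C) (a : nat -> C) : Prop :=
  forall z, upper z ->
    series (fun n => a n.+1 * qexp z ^+ n.+1 : C^o) @ \oo --> (f z : C^o).

(* The n-th coefficient of T_p f, where f = sum a_n q^n has weight k and
   character chi; for p dividing the level, chi p = 0 and this is U_p. *)
Definition hecke_coef (k : nat) (chi : int -> int) (a : nat -> C)
    (p n : nat) : C :=
  a (p * n)%N + (chi p%:Z)%:~R * p%:R ^+ k.-1 *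
    (if (p %| n)%N then a (n %/ p)%N else 0).

(* Newforms of level N whose character is primitive mod N. An oldform of level N
   and character chi comes from some S_k(Gamma_0(M), chi') with M a proper
   divisor of N and chi' inducing chi; for chi primitive mod N there are none,
   so the new subspace is all of S_k(Gamma_0(N), chi), and the newforms are the
   normalized eigenforms of all Hecke operators. *)
Record newform_primitive_char (N k : nat) (chi : int -> int)
    (f : C -> C) (a : nat -> C) : Prop := {
  newform_char : primitive_mod N chi;
  newform_cusp : cusp_form N k chi f;
  newform_qexp : q_expansion f a;
  newform_eigen : forall p : nat, prime p -> exists lambda : C,
    forall n : nat, (0 < n)%N -> hecke_coef k chi a p n = lambda * a n;
  newform_normalized : a 1%N = 1
}.

(* Complex multiplication by the quadratic field with character phi. *)
Definition has_CM (N : nat) (phi : int -> int) (a : nat -> C) : Prop :=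
  forall p : nat, prime p -> ~~ (p %| N)%N -> (phi p%:Z)%:~R * a p = a p.

Definition sqrt_m2 : C := sqrtC (-2).

Record is_g (k : nat) (g : C -> C) (beta : nat -> C) : Prop := {
  g_newform : newform_primitive_char 8 k kronecker_m8 g beta;
  g_CM : has_CM 8 kronecker_m8 beta;
  g_split : forall p : nat, prime p ->
    (p %% 8 = 1)%N \/ (p %% 8 = 3)%N ->
    forall c d : int, p%:Z = c ^+ 2 + 2 * d ^+ 2 ->
    beta p = (c%:~R + d%:~R * sqrt_m2) ^+ (k - 1)
           + (c%:~R - d%:~R * sqrt_m2) ^+ (k - 1);
  g_ramified : beta 2%N = (-2) ^+ ((k - 1) %/ 2)%N;
  g_inert : forall p : nat, prime p -> p <> 2%N ->
    (p %% 8 <> 1)%N -> (p %% 8 <> 3)%N -> beta p = 0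
}.

(* x = z mod m, where the complex number z is required to be an integer. *)
Definition int_congr (m : nat) (x : int) (z : C) : Prop :=
  exists2 y : int, z = y%:~R & (x = y %[mod m])%Z.

End ModularForms.

(* Main.v *)
Require Import Defs.
From mathcomp Require Import all_boot all_order all_algebra complex.
From mathcomp Require Import all_classical all_reals all_analysis.
From mathcomp Require Import all_solvable all_field ring zify.
Local Open Scope ring_scope.
Set Implicit Arguments.
Unset Strict Implicit.
Unset Printing Implicit Defensive.
Import Order.TTheory GRing.Theory Num.Theory.

(* Let m = (p - 1) / 2. Franel numbers satisfy D(M p + m) = D(M) D(m) mod p
   for m < p (Lucas), and all digits of (p^r - 1) / 2 in base p equal m, so
   everything reduces to D(m). MacMahon's identity turns D(m) into
     2^m sum_k C(m, 2k) C(2k, k) C(m + k, k) 4^(-k),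
   and modulo p, where m = -1/2, this sum is
     sum_k C(n + k, 2k) C(2k, k)^2 (-1/4)^k = P_n(0)^2   with n = floor(p / 4).
   It vanishes for n odd, that is for p = 5, 7 mod 8. For n = 2 e it equals
   (C(2e, e) / 4^e)^2 = C(m, e)^2 mod p. When p = 1 mod 8 a Jacobi sum, and when
   p = 3 mod 8 an Eisenstein sum, of characters of order 8 lies in Z[sqrt(-2)],
   has norm p, and its trace 2 c is C(m, e) mod p up to sign. This provides
   p = c^2 + 2 d^2 with (-1)^m D(m) = (-2)^m (2 c)^2 = (2 c)^2 mod p; finally
   (c + d sqrt(-2))^(2r) + (c - d sqrt(-2))^(2r) = (2 c)^(2r) mod p. *)

(** * Binomial sums and MacMahon's identity for Franel numbers *)

Lemma bin_mul_bin (n k a : nat) : (a <= k)%N ->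
  ('C(n, k) * 'C(k, a) = 'C(n, a) * 'C(n - a, k - a))%N.
Proof.
move=> ak; have [nk|kn] := ltnP n k.
  rewrite (bin_small nk) mul0n; have [na|an] := ltnP n a.
    by rewrite (bin_small na).
  by rewrite (@bin_small (n - a)) ?muln0 //; lia.
have f0 : (0 < a`! * (k - a)`! * (n - k)`!)%N by rewrite !muln_gt0 !fact_gt0.
apply/eqP; rewrite -(eqn_pmul2r f0); apply/eqP.
have E1 := bin_fact kn; have E2 := bin_fact ak.
have E3 := bin_fact (leq_trans ak kn).
have ka : (k - a <= n - a)%N by lia.
have E4 := bin_fact ka.
have E5 : (n - a - (k - a) = n - k)%N by lia.
rewrite E5 in E4.
transitivity n`!%N; first by rewrite -E1 -E2; lia.
by rewrite -E3 -E4; lia.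
Qed.

(** Three Vandermonde convolutions: the first expands ['C(n + j, a + b)] over [i], the second
    performs the inner sum over [j], the third collects the sum over [i]. *)
Lemma sum_bin_bin_shift (a b n : nat) :
  (\sum_(j < a.+1) 'C(a, j) * 'C(b, j) * 'C(n + j, a + b)
   = 'C(n, a) * 'C(n, b))%N.
Proof.
have inner (i : nat) : (\sum_(j < a.+1) 'C(a, j) * 'C(b, j) * 'C(j, i)
    = 'C(a, i) * 'C(b + (a - i), a))%N.
  rewrite -binomial.Vandermonde big_distrr /=; apply: eq_bigr => j _.
  have [ji|ij] := ltnP j i.
    rewrite (bin_small ji) muln0; have [ai|ia] := ltnP a i.
      by rewrite (bin_small ai).
    by rewrite (@bin_small (a - i) (a - j)) ?muln0 //; have := ltn_ord j; lia.
  have ja : (j <= a)%N by rewrite -ltnS.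
  rewrite mulnAC bin_mul_bin // -mulnA; congr (_ * _)%N; rewrite mulnC.
  congr (_ * _)%N; rewrite -bin_sub; last by lia.
  by congr 'C(_, _); lia.
transitivity (\sum_(i < (a + b).+1)
    'C(n, a + b - i) * ('C(a, i) * 'C(b + (a - i), a)))%N.
  under eq_bigr => j _ do rewrite addnC -binomial.Vandermonde big_distrr /=.
  rewrite exchange_big /=; apply: eq_bigr => i _.
  by rewrite -inner big_distrr; apply: eq_bigr => j _ /=; lia.
have [na|an] := ltnP n a.
  rewrite (bin_small na) mul0n big1 // => i _.
  have [ab|ab] := ltnP (b + (a - i)) a; first by rewrite (bin_small ab) !muln0.
  have [ai|ia] := ltnP a i; first by rewrite (bin_small ai) muln0.
  by rewrite (@bin_small n (a + b - i)) //; lia.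
have := binomial.Vandermonde a (n - a) b; rewrite subnKC // => <-.
rewrite big_distrr /=.
rewrite (big_ord_widen (a + b).+1
  (fun i => 'C(n, a) * ('C(a, i) * 'C(n - a, b - i)))%N); last by lia.
rewrite [RHS]big_mkcond; apply: eq_bigr => i _ /=.
have [ai|ia] := ltnP a i; first by rewrite (bin_small ai) !muln0 if_same.
rewrite ltnS; case: leqP => ib; last first.
  by rewrite (@bin_small (b + (a - i))) ?muln0 //; lia.
have -> : (b + (a - i) = a + b - i)%N by lia.
rewrite mulnCA bin_mul_bin; last by lia.
by rewrite mulnCA; congr (_ * (_ * 'C(_, _)))%N; lia.
Qed.

(* MacMahon: expand one factor ['C(n, k) ^ 2] by [sum_bin_bin_shift]
   and sum over [k] first. *)
Lemma franelE (n : nat) : franel n =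
  (\sum_(j < n.+1) 'C(n, j.*2) * 'C(j.*2, j) * 'C(n + j, j) * 2 ^ (n - j.*2))%N.
Proof.
transitivity (\sum_(k < n.+1) \sum_(j < n.+1)
    'C(n, k) * ('C(k, j) * 'C(n - k, j) * 'C(n + j, j)))%N.
  apply: eq_bigr => k _; have kn : (k <= n)%N by rewrite -ltnS.
  have := sum_bin_bin_shift k (n - k) n.
  rewrite subnKC // bin_sub // -big_distrr /= expnS expnS expn1 => <-.
  congr (_ * _)%N.
  rewrite (big_ord_widen n.+1
    (fun i => 'C(k, i) * 'C(n - k, i) * 'C(n + i, n))%N) //.
  rewrite big_mkcond; apply: eq_bigr => j _ /=.
  rewrite -[in RHS](@bin_sub (n + j)) ?addnK ?leq_addl //.
  by case: ltnP => // kj; rewrite (bin_small kj).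
rewrite exchange_big; apply: eq_bigr => j _ /=.
(* Choosing [k] of [n] elements, then [j] inside and [j] outside, amounts to choosing the [j.*2]
   marked ones first; what remains sums over [k] to [2 ^ (n - j.*2)]. The test [j <= k] guards the
   truncated [k - j]. *)
have -> : ('C(n, j.*2) * 'C(j.*2, j) * 'C(n + j, j) * 2 ^ (n - j.*2) =
  \sum_(k < n.+1) 'C(n, j.*2) * 'C(j.*2, j) * 'C(n + j, j) *
    (if j <= k then 'C(n - j.*2, k - j) else 0))%N; last first.
  apply: eq_bigr => k _; have kn : (k <= n)%N by rewrite -ltnS.
  case: leqP => jk; last by rewrite (bin_small jk) !(mul0n, muln0).
  rewrite [LHS]mulnA [RHS]mulnAC; congr (_ * _)%N.
  have [s|s] := ltnP (n - k) j.
    rewrite (bin_small s) !muln0; have [s'|s'] := ltnP n j.*2.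
      by rewrite (bin_small s') !mul0n.
    by rewrite (@bin_small (n - j.*2)) ?muln0 //; lia.
  rewrite mulnA (bin_mul_bin n jk) [in RHS]bin_mul_bin; last by lia.
  rewrite -!mulnA; congr (_ * _)%N.
  have -> : (n - k = n - j - (k - j))%N by lia.
  have -> : (j.*2 - j = j)%N by lia.
  rewrite -[in LHS](@bin_sub (n - j) (k - j)); last by lia.
  have s2 : (j <= n - j - (k - j))%N by lia.
  rewrite bin_mul_bin //.
  have -> : (n - j.*2 = n - j - j)%N by lia.
  rewrite -[in RHS](@bin_sub _ (k - j)); last by lia.
  by congr (_ * 'C(_, _))%N; lia.
rewrite -big_distrr /=.
have [s|s] := ltnP n j.*2; first by rewrite (bin_small s) !mul0n.
congr (_ * _)%N.
rewrite -(big_mkord xpredT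
  (fun k => if (j <= k)%N then 'C(n - j.*2, k - j) else 0%N)).
rewrite (@big_cat_nat _ _ _ j) //=; last by lia.
rewrite [X in (X + _)%N]big_nat big1 ?add0n; last first.
  by move=> i /andP[_ ij]; rewrite leqNgt ij.
rewrite -{2}(add0n (j : nat)) big_addn (@big_cat_nat _ _ _ (n - j.*2).+1) //=;
  last by lia.
rewrite [X in (_ + X)%N]big_nat [X in (_ + X)%N]big1 ?addn0; last first.
  by move=> i /andP[s1 _]; rewrite leq_addl addnK bin_small.
rewrite -[2%N]/(1 + 1)%N expnDn big_mkord; apply: eq_bigr => i _.
by rewrite leq_addl addnK !exp1n !muln1.
Qed.

(** * Binomial recurrences in a ring, and evaluation of the sum of [legendre_sq] *)

Lemma natr_bin_left (A : pzRingType) (n k : nat) :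
  k.+1%:R * 'C(n, k.+1)%:R = (n%:R - k%:R) * 'C(n, k)%:R :> A.
Proof.
rewrite -natrM mul_bin_left natrM; have [nk|kn] := ltnP n k.
  by rewrite (bin_small nk) !mulr0.
by rewrite natrB.
Qed.

Lemma natr_bin_diag (A : pzRingType) (n k : nat) :
  k.+1%:R * 'C(n.+1, k.+1)%:R = n.+1%:R * 'C(n, k)%:R :> A.
Proof. by rewrite -!natrM -mul_bin_diag. Qed.

Lemma natr_bin_central (A : comPzRingType) (k : nat) :
  k.+1%:R * 'C(k.+1.*2, k.+1)%:R = 2 * (2 * k%:R + 1) * 'C(k.*2, k)%:R :> A.
Proof.
rewrite doubleS natr_bin_diag -(@bin_sub k.*2.+1); last by lia.
have -> : (k.*2.+1 - k = k.+1)%N by lia.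
have -> : k.*2.+2%:R = 2 * k.+1%:R :> A by rewrite -doubleS -muln2 mulnC natrM.
by rewrite -[LHS]mulrA natr_bin_diag mulrA -[k.*2.+1%:R]natr1 -[in k.*2%:R]mul2n natrM.
Qed.

(* By Clausen's formula, the sum over [k] is [P_n(0) ^ 2], where [P_n] is the
   Legendre polynomial; it is evaluated below by Zeilberger's method. *)
Definition legendre_sq (A : fieldType) (n k : nat) : A :=
  (- 4^-1) ^+ k * 'C(n + k, k.*2)%:R * 'C(k.*2, k)%:R ^+ 2.

(** The right-hand side is Zeilberger's certificate for a recurrence of step 2 in [n]; once it is
    known, induction on [K] leaves a rational identity. *)
Lemma legendre_sq_telescope (A : numFieldType) (n K : nat) :
  \sum_(k < K.+1) ((n%:R + 2) ^+ 2 * legendre_sq A n.+2 k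
                   - (n%:R + 1) ^+ 2 * legendre_sq A n k)
  = (2 * n%:R + 3) * (2 * K%:R + 1) * (- 4^-1) ^+ K
    * 'C(K.*2, K)%:R ^+ 2 * 'C((n + K).+1, K.*2)%:R.
Proof.
elim: K => [|k IH].
  by rewrite big_ord1 /legendre_sq !bin0 !expr0; ring.
rewrite big_ord_recr /= IH {IH} /legendre_sq.
have n0 i : (i.+1%:R : A) != 0 by rewrite pnatr_eq0.
have c1 : 'C(k.+1.*2, k.+1)%:R
    = 2 * (2 * k%:R + 1) / (k%:R + 1) * 'C(k.*2, k)%:R :> A.
  have k0 := n0 k; apply: (mulfI k0); rewrite natr_bin_central.
  by rewrite -natr1 in k0 *; field.
rewrite c1 {c1} -addnS doubleS addSn addSn addnS.
(* Every binomial with upper index [N], [N.+1] or [N.+2] becomes a rational multiple of [b]. *)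
set N := (n + k).+1; set b : A := 'C(N, k.*2)%:R.
have D1 : 2 * k%:R + 1 != 0 :> A by rewrite -natrM natr1 n0.
have D2 : 2 * k%:R + 2 != 0 :> A by rewrite -natrM -natrD addn2 n0.
have D3 : k%:R + 1 != 0 :> A by rewrite natr1 n0.
have dk : k.*2%:R = 2 * k%:R :> A by rewrite -mul2n natrM.
have dk1 : k.*2.+1%:R = 2 * k%:R + 1 :> A by rewrite -natr1 dk.
have dk2 : k.*2.+2%:R = 2 * k%:R + 2 :> A by rewrite -addn2 natrD dk.
have N1 : N.+1%:R = N%:R + 1 :> A by rewrite natr1.
have N2 : N.+2%:R = N%:R + 2 :> A by rewrite -addn2 natrD.
have E1 : (2 * k%:R + 1) * 'C(N, k.*2.+1)%:R = (N%:R - 2 * k%:R) * b.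
  by rewrite -dk1 natr_bin_left dk.
have E2 : (2 * k%:R + 2) * 'C(N.+1, k.*2.+2)%:R
    = (N%:R + 1) * 'C(N, k.*2.+1)%:R :> A.
  by rewrite -dk2 natr_bin_diag N1.
have E3 : (2 * k%:R + 2) * 'C(N, k.*2.+2)%:R
    = (N%:R - 2 * k%:R - 1) * 'C(N, k.*2.+1)%:R :> A.
  by rewrite -dk2 natr_bin_left dk1 opprD addrA.
have E4 : (2 * k%:R + 2) * 'C(N.+2, k.*2.+2)%:R
    = (N%:R + 2) * 'C(N.+1, k.*2.+1)%:R :> A.
  by rewrite -dk2 natr_bin_diag N2.
have E5 : (2 * k%:R + 1) * 'C(N.+1, k.*2.+1)%:R = (N%:R + 1) * b.
  by rewrite -dk1 natr_bin_diag N1.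
have F1 : 'C(N, k.*2.+1)%:R = (N%:R - 2 * k%:R) * b / (2 * k%:R + 1).
  by rewrite -E1 mulrC mulKf.
have F5 : 'C(N.+1, k.*2.+1)%:R = (N%:R + 1) * b / (2 * k%:R + 1).
  by rewrite -E5 mulrC mulKf.
have F2 : 'C(N.+1, k.*2.+2)%:R
    = (N%:R + 1) * 'C(N, k.*2.+1)%:R / (2 * k%:R + 2) :> A.
  by rewrite -E2 mulrC mulKf.
have F3 : 'C(N, k.*2.+2)%:R
    = (N%:R - 2 * k%:R - 1) * 'C(N, k.*2.+1)%:R / (2 * k%:R + 2) :> A.
  by rewrite -E3 mulrC mulKf.
have F4 : 'C(N.+2, k.*2.+2)%:R
    = (N%:R + 2) * 'C(N.+1, k.*2.+1)%:R / (2 * k%:R + 2) :> A.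
  by rewrite -E4 mulrC mulKf.
rewrite F4 F3 F2 F5 F1 [(- 4^-1) ^+ k.+1]exprS -[k.+1%:R]natr1 /N -[(n + k).+1%:R]natr1 natrD.
by field; rewrite D1 D2 D3.
Qed.

(** At [K = n + 2] the certificate contains C(2n + 3, 2n + 4) = 0, and the terms of index [n + 1]
    and [n + 2] in the shorter sum vanish too. *)
Lemma sum_legendre_sq_rec (A : numFieldType) (n : nat) :
  (n%:R + 2) ^+ 2 * (\sum_(k < n.+3) legendre_sq A n.+2 k)
  = (n%:R + 1) ^+ 2 * (\sum_(k < n.+1) legendre_sq A n k).
Proof.
have := legendre_sq_telescope A n n.+2.
rewrite [X in _ = X -> _](_ : _ = 0); last first.
  by rewrite (@bin_small (n + n.+2).+1) ?mulr0 //; lia.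
rewrite sumrB -!mulr_sumr => /eqP; rewrite subr_eq0 => /eqP ->.
rewrite !big_ord_recr /= /legendre_sq.
rewrite (@bin_small (n + n.+1)) ?(@bin_small (n + n.+2)); try lia.
by rewrite !(mulr0, mul0r, addr0).
Qed.

Lemma sum_legendre_sq_odd_num (A : numFieldType) (n : nat) : odd n ->
  \sum_(k < n.+1) legendre_sq A n k = 0.
Proof.
move=> on; rewrite -(odd_double_half n) on add1n; move: n./2 => {n on}; elim.
  rewrite big_ord_recr big_ord1 /legendre_sq /=.
  rewrite -['C(1 + 0, 0)]/1%N -['C(0, 0)]/1%N -['C(1 + 1, 2)]/1%N.
  by rewrite -['C(2, 1)]/2%N; field.
move=> n IH; have := sum_legendre_sq_rec A n.*2.+1.
rewrite IH mulr0 => /eqP; rewrite mulf_eq0 expf_eq0 /= -natrD pnatr_eq0 addn2 /=.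
by rewrite doubleS => /eqP.
Qed.

Lemma sum_legendre_sq_even_num (A : numFieldType) (e : nat) :
  \sum_(k < e.*2.+1) legendre_sq A e.*2 k = ('C(e.*2, e)%:R / 4 ^+ e) ^+ 2.
Proof.
elim: e => [|e IH].
  by rewrite big_ord1 /legendre_sq /= bin0 !expr0; field.
have := sum_legendre_sq_rec A e.*2; rewrite -doubleS IH.
have e0 : e%:R + 1 != 0 :> A by rewrite natr1 pnatr_eq0.
have -> : 'C(e.+1.*2, e.+1)%:R
    = 2 * (2 * e%:R + 1) / (e%:R + 1) * 'C(e.*2, e)%:R :> A.
  by apply: (mulfI e0); rewrite {1}natr1 natr_bin_central; field.
have d0 : (2 * e%:R + 2) ^+ 2 != 0 :> A.
  by rewrite expf_eq0 /= -natrM -natrD addn2 pnatr_eq0.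
have s0 : 4 ^+ e != 0 :> A by rewrite expf_eq0 pnatr_eq0 andbF.
have -> : (e.*2%:R = 2 * e%:R :> A) by rewrite -muln2 mulnC natrM.
move=> E; apply: (mulfI d0); rewrite E [4 ^+ e.+1]exprS; field.
by rewrite s0 e0.
Qed.

(** Clearing denominators leaves an integer independent of [A], so the evaluations in characteristic
    0 pass from [rat] to every field where 4 is invertible. *)
Lemma sum_legendre_sq_int (A : fieldType) (n : nat) : (4 : A) != 0 ->
  4 ^+ n * (\sum_(k < n.+1) legendre_sq A n k) =
  (\sum_(k < n.+1) (-1) ^+ k * 4 ^+ (n - k) * 'C(n + k, k.*2)%:R
     * 'C(k.*2, k)%:R ^+ 2 : int)%:~R.
Proof.
move=> n4; rewrite mulr_sumr raddf_sum /=; apply: eq_bigr => k _.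
have kn : (k <= n)%N by rewrite -ltnS.
rewrite /legendre_sq !rmorphM !rmorphXn /= !rmorphN1 !rmorph_nat.
rewrite -{1}(subnK kn) exprD -[- 4^-1]mulN1r exprMn exprVn.
have n4k : (4 : A) ^+ k != 0 by rewrite expf_neq0.
by field.
Qed.

Lemma sum_legendre_sq_odd (A : fieldType) (n : nat) : (4 : A) != 0 -> odd n ->
  \sum_(k < n.+1) legendre_sq A n k = 0.
Proof.
move=> n4 on; have n4n : (4 : A) ^+ n != 0 by rewrite expf_neq0.
apply: (mulfI n4n); rewrite sum_legendre_sq_int // mulr0.
have := @sum_legendre_sq_int rat n isT.
rewrite sum_legendre_sq_odd_num // mulr0 => /esym/eqP.
by rewrite intr_eq0 => /eqP ->.
Qed.

Lemma sum_legendre_sq_even (A : fieldType) (e : nat) : (4 : A) != 0 ->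
  \sum_(k < e.*2.+1) legendre_sq A e.*2 k = ('C(e.*2, e)%:R / 4 ^+ e) ^+ 2.
Proof.
move=> n4; have n4n : (4 : A) ^+ e != 0 by rewrite expf_neq0.
have n4n2 : (4 : A) ^+ e.*2 != 0 by rewrite expf_neq0.
have := @sum_legendre_sq_int rat e.*2 isT.
rewrite sum_legendre_sq_even_num // -addnn exprD addnn.
have -> : 4 ^+ e * 4 ^+ e * ('C(e.*2, e)%:R / 4 ^+ e) ^+ 2
    = ('C(e.*2, e)%:R ^+ 2)%:~R :> rat.
  have q4 : (4 : rat) ^+ e != 0 by rewrite expf_neq0.
  by rewrite rmorphXn /= rmorph_nat; field.
move=> /intr_inj E; apply: (mulfI n4n2); rewrite sum_legendre_sq_int //.
have D : (4 : A) ^+ e.*2 = 4 ^+ e * 4 ^+ e by rewrite -addnn exprD.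
by rewrite -E rmorphXn /= rmorph_nat D; field.
Qed.

(** * Franel numbers at (p - 1) / 2 in characteristic p *)

Lemma natr_pchar_neq0 (A : nzRingType) (p k : nat) :
  p \in [pchar A] -> (0 < k < p)%N -> k%:R != 0 :> A.
Proof. by move=> cA /andP[k0 kp]; rewrite -(dvdn_pcharf cA) gtnNdvd. Qed.

Lemma natr_half_pchar (A : fieldType) (p : nat) : p \in [pchar A] -> odd p ->
  (p./2)%:R = - 2^-1 :> A.
Proof.
move=> cA op; have p2 := odd_prime_gt2 op (pcharf_prime cA).
have n2 : 2%:R != 0 :> A by apply: (natr_pchar_neq0 cA).
apply: (mulfI n2); rewrite mulrN divff // -natrM mul2n.
have E : (p./2.*2.+1 = p)%N by rewrite -[RHS]odd_double_half op.
by apply/eqP; rewrite -addr_eq0 natr1 E -(dvdn_pcharf cA).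
Qed.

(* Both sides are hypergeometric in [k], with the same ratio of consecutive
   terms because [m = - 1/2] and [4 n = - 1] or [4 n = - 3] in [A]. *)
Lemma franel_term_pchar (A : fieldType) (p k : nat) (m := p./2) (n := (p %/ 4)%N) :
  p \in [pchar A] -> odd p -> (k <= m)%N ->
  'C(m, k.*2)%:R * 'C(k.*2, k)%:R * 'C(m + k, k)%:R / 4 ^+ k
  = legendre_sq A n k.
Proof.
move=> cA op; have p2 := odd_prime_gt2 op (pcharf_prime cA).
have n2 : 2 != 0 :> A by apply: (natr_pchar_neq0 cA).
have n4 : 4 != 0 :> A by rewrite -[4%:R]/((2 * 2)%N%:R) natrM mulf_neq0.
have n16 : 16 != 0 :> A by rewrite -[16%:R]/((4 * 4)%N%:R) natrM mulf_neq0.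
have Em : m%:R = - 2^-1 :> A by apply: natr_half_pchar.
have En : n%:R ^+ 2 + n%:R = - (3 / 16) :> A.
  (* One of the two factors is [p]. *)
  have E0 : ((4 * n + 1) * (4 * n + 3))%N%:R = 0 :> A.
    apply/eqP; rewrite -(dvdn_pcharf cA); apply/dvdnP.
    have := divn_eq p 4; rewrite -/n => E; have : (p %% 4 < 4)%N by rewrite ltn_mod.
    have := modn2 p; rewrite op => M.
    have [r1|r3] : (p %% 4 = 1 \/ p %% 4 = 3)%N by lia.
      by exists (4 * n + 3)%N; rewrite E r1; lia.
    by exists (4 * n + 1)%N; rewrite E r3; lia.
  apply: (mulfI n16); rewrite !(natrM, natrD) in E0.
  transitivity ((4 * n%:R + 1) * (4 * n%:R + 3) - 3 : A); first by ring.
  by rewrite E0; field.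
elim: k => [|k IH] km.
  by rewrite /legendre_sq /= !bin0 !expr0 invr1 ?mulr1 expr1n ?mulr1.
have {}IH := IH (ltnW km).
have nz j : (0 < j < p)%N -> j%:R != 0 :> A by apply: (natr_pchar_neq0 cA).
have mp : (m.*2.+1 = p)%N by rewrite /m -[RHS]odd_double_half op.
have d1 : k%:R + 1 != 0 :> A by rewrite natr1 nz //; lia.
have d2 : 2 * k%:R + 1 != 0 :> A by rewrite -natrM natr1 nz //; lia.
have d3 : 2 * k%:R + 2 != 0 :> A by rewrite -natrM -natrD nz //; lia.
have dk : k.*2%:R = 2 * k%:R :> A by rewrite -mul2n natrM.
have dk1 : k.*2.+1%:R = 2 * k%:R + 1 :> A by rewrite -natr1 dk.
have dk2 : k.*2.+2%:R = 2 * k%:R + 2 :> A by rewrite -addn2 natrD dk.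
have c1 : 'C(k.+1.*2, k.+1)%:R
    = 2 * (2 * k%:R + 1) / (k%:R + 1) * 'C(k.*2, k)%:R :> A.
  by apply: (mulfI d1); rewrite {1}natr1 natr_bin_central; field.
have c2 : 'C(m, k.*2.+2)%:R = (m%:R - 2 * k%:R - 1) * (m%:R - 2 * k%:R)
     / (2 * k%:R + 1) / (2 * k%:R + 2) * 'C(m, k.*2)%:R :> A.
  have E1 := natr_bin_left A m k.*2; have E2 := natr_bin_left A m k.*2.+1.
  rewrite dk1 dk in E1; rewrite dk2 dk1 in E2; apply: (mulfI d3).
  rewrite E2; apply: (mulfI d2); rewrite mulrCA E1; field.
  by rewrite d2 d3.
have c3 : 'C((m + k).+1, k.+1)%:R
    = (m%:R + k%:R + 1) / (k%:R + 1) * 'C(m + k, k)%:R :> A.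
  by apply: (mulfI d1); rewrite {1}natr1 natr_bin_diag -[(m + k).+1%:R]natr1 natrD; field.
have c4 : 'C((n + k).+1, k.*2.+2)%:R = (n%:R + k%:R + 1) * (n%:R - k%:R)
     / (2 * k%:R + 1) / (2 * k%:R + 2) * 'C(n + k, k.*2)%:R :> A.
  have E1 := natr_bin_left A (n + k) k.*2.
  have E2 := natr_bin_diag A (n + k) k.*2.+1.
  rewrite dk1 dk natrD in E1; rewrite dk2 -[(n + k).+1%:R]natr1 natrD in E2.
  apply: (mulfI d3); rewrite E2; apply: (mulfI d2); rewrite mulrCA E1; field.
  by rewrite d2 d3.
(* Here the two ratios meet: the left side depends on [n] only through [n ^ 2 + n], which is the
   same for both odd residues of [p] mod 4. *)
have c5 : (n%:R + k%:R + 1) * (n%:R - k%:R) =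
    - (m%:R - 2 * k%:R - 1) * (m%:R - 2 * k%:R) / 4 :> A.
  transitivity (n%:R ^+ 2 + n%:R - k%:R ^+ 2 - k%:R : A); first by ring.
  rewrite En Em; field.
  by rewrite ?n2 ?n4 ?n16.
have c6 : m%:R + k%:R + 1 = (2 * k%:R + 1) / 2 :> A by rewrite Em; field.
rewrite /legendre_sq !addnS [X in X * _ / _]mulrC c1 doubleS c2 c3 c4 c5 c6.
rewrite [4 ^+ k.+1]exprS [(- 4^-1) ^+ k.+1]exprS.
transitivity ('C(m, k.*2)%:R * 'C(k.*2, k)%:R * 'C(m + k, k)%:R / 4 ^+ k *
   ((m%:R - 2 * k%:R - 1) * (m%:R - 2 * k%:R) * (2 * k%:R + 1) / 4
     / (2 * k%:R + 2) / (k%:R + 1) ^+ 2) : A).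
  have k4 : 4 ^+ k != 0 :> A by rewrite expf_neq0.
  by field; rewrite ?n2 ?n4 ?k4 ?d1 ?d2 ?d3.
rewrite IH /legendre_sq; field.
by rewrite ?n2 ?n4 ?d1 ?d2 ?d3.
Qed.

Lemma franel_half_pchar (A : fieldType) (p : nat) : p \in [pchar A] -> odd p ->
  (franel p./2)%:R
  = 2 ^+ p./2 * (\sum_(k < (p %/ 4).+1) legendre_sq A (p %/ 4) k).
Proof.
move=> cA op; have p2 := odd_prime_gt2 op (pcharf_prime cA).
have n2 : 2 != 0 :> A by apply: (natr_pchar_neq0 cA).
set m := p./2; set n := (p %/ 4)%N.
have nm : (n.+1 <= m.+1)%N.
  by rewrite /n /m -divn2; lia.
rewrite (big_ord_widen _ (fun k => legendre_sq A n k) nm) big_mkcond /=.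
rewrite franelE natr_sum mulr_sumr; apply: eq_bigr => k _.
have km : (k <= m)%N by rewrite -ltnS.
(* Extending the sum from [n] to [m] adds only zeros, as C(n + k, 2k) = 0 for [k > n]. *)
have -> : (if (k < n.+1)%N then legendre_sq A n k else 0) = legendre_sq A n k.
  by case: ltnP => // nk; rewrite /legendre_sq (@bin_small (n + k)) ?mulr0 ?mul0r //; lia.
rewrite -(franel_term_pchar cA) // -/m !natrM.
have [k2|k2] := ltnP m k.*2; first by rewrite (bin_small k2) !(mul0r, mulr0).
have n4 : 4 != 0 :> A by rewrite -[4%:R]/((2 * 2)%N%:R) natrM mulf_neq0.
have -> : 2 ^+ m = 2 ^+ (m - k.*2) * 4 ^+ k :> A.
  rewrite -{1}(subnK k2) exprD; congr (_ * _).
  by rewrite -mul2n exprM -natrX.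
have k4 : 4 ^+ k != 0 :> A by rewrite expf_neq0.
by rewrite natrX; field.
Qed.

(** The classical formula for C(-1/2, k), available because [p./2] is -1/2 in [A] and the factors
    [k.+1] stay invertible. *)
Lemma bin_half_pchar (A : fieldType) (p k : nat) :
  p \in [pchar A] -> odd p -> (k <= p./2)%N ->
  'C(p./2, k)%:R = (- 4^-1) ^+ k * 'C(k.*2, k)%:R :> A.
Proof.
move=> cA op; have p2 := odd_prime_gt2 op (pcharf_prime cA).
have n2 : 2 != 0 :> A by apply: (natr_pchar_neq0 cA).
have n4 : 4 != 0 :> A by rewrite -[4%:R]/((2 * 2)%N%:R) natrM mulf_neq0.
elim: k => [|k IH] km; first by rewrite /= !bin0 expr0 mulr1.
have d1 : k.+1%:R != 0 :> A.
  by apply: (natr_pchar_neq0 cA); rewrite -divn2 in km; lia.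
apply: (mulfI d1); rewrite mulrCA natr_bin_central natr_bin_left.
have -> := IH (ltnW km).
have -> := natr_half_pchar cA op.
rewrite exprS; field.
by rewrite ?n2 ?n4.
Qed.

Lemma franel_half_inert (A : fieldType) (p : nat) :
  p \in [pchar A] -> odd p -> odd (p %/ 4) -> (franel p./2)%:R = 0 :> A.
Proof.
move=> cA op on; have p2 := odd_prime_gt2 op (pcharf_prime cA).
have n2 : 2 != 0 :> A by apply: (natr_pchar_neq0 cA).
have n4 : 4 != 0 :> A by rewrite -[4%:R]/((2 * 2)%N%:R) natrM mulf_neq0.
by rewrite (franel_half_pchar cA op) sum_legendre_sq_odd // mulr0.
Qed.

Lemma franel_half_split (A : fieldType) (p : nat) :
  p \in [pchar A] -> odd p -> ~~ odd (p %/ 4) ->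
  (franel p./2)%:R = 2 ^+ p./2 * 'C(p./2, p %/ 8)%:R ^+ 2 :> A.
Proof.
move=> cA op on; have p2 := odd_prime_gt2 op (pcharf_prime cA).
have n2 : 2 != 0 :> A by apply: (natr_pchar_neq0 cA).
have n4 : 4 != 0 :> A by rewrite -[4%:R]/((2 * 2)%N%:R) natrM mulf_neq0.
have E : (p %/ 4 = (p %/ 8).*2)%N by lia.
rewrite (franel_half_pchar cA op) E sum_legendre_sq_even //; congr (_ * _).
rewrite (bin_half_pchar cA op); last by rewrite -divn2; lia.
have -> : (- 4^-1) ^+ (p %/ 8) = (-1) ^+ (p %/ 8) / 4 ^+ (p %/ 8) :> A.
  by rewrite -[- 4^-1]mulN1r exprMn exprVn.
by rewrite -mulrA [RHS]exprMn sqrr_sign mul1r mulrC.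
Qed.

(** * Lucas' theorem and the reduction from (p^r - 1) / 2 to (p - 1) / 2 *)

Lemma coef_XD1_exp (A : nzSemiRingType) (n i : nat) :
  (('X + 1 : {poly A}) ^+ n)`_i = 'C(n, i)%:R.
Proof.
rewrite exprD1n coef_sum; under eq_bigr => j _ do rewrite coefMn coefXn.
have [ni|ij] := ltnP n i.
  rewrite (bin_small ni) big1 // => j _; rewrite gtn_eqF ?mul0rn //.
  by apply: leq_trans ni; rewrite ltnS -ltnS.
rewrite (bigD1 (Ordinal (ij : (i < n.+1)%N))) //= eqxx big1 ?addr0 // => j.
by rewrite -val_eqE /= eq_sym => /negPf ->; rewrite mul0rn.
Qed.

(** Compare coefficients in (X + 1)^(M p + m) = (X^p + 1)^M (X + 1)^m. *)
Lemma Lucas (A : comNzRingType) (p m j M J : nat) :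
  p \in [pchar A] -> (m < p)%N -> (j < p)%N ->
  'C(M * p + m, J * p + j)%:R = 'C(M, J)%:R * 'C(m, j)%:R :> A.
Proof.
move=> cA mp jp; rewrite -coef_XD1_exp exprD exprM.
have cP : p \in [pchar {poly A}] by rewrite pchar_poly.
have -> : ('X + 1) ^+ M ^+ p = ('X^p + 1 : {poly A}) ^+ M.
  by rewrite exprAC exprDn_pchar ?expr1n // pnatE ?(pcharf_prime cA).
rewrite exprD1n big_distrl coef_sum /=.
under eq_bigr => i _ do rewrite -exprM mulrnAl coefMn mulrC coefMXn coef_XD1_exp.
(* For [i < J] the remaining degree exceeds [m]; for [i > J] it would be negative. *)
have off (i : nat) : i != J ->
    (if (J * p + j < p * i)%N then 0 else 'C(m, J * p + j - p * i)%:R : A) = 0.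
  rewrite neq_ltn => /orP[ij|ij].
    case: ifP => // _; rewrite bin_small //.
    have : (i.+1 * p <= J * p)%N by rewrite leq_mul2r ij orbT.
    by rewrite mulSn; move: mp; rewrite (mulnC p); lia.
  rewrite ifT //; have : (J.+1 * p <= i * p)%N by rewrite leq_mul2r ij orbT.
  by rewrite mulSn (mulnC p); lia.
have [MJ|JM] := ltnP M J.
  rewrite (bin_small MJ) mul0r big1 // => i _; rewrite off ?mul0rn //.
  by rewrite ltn_eqF //; apply: leq_trans MJ; rewrite ltnS -ltnS.
rewrite (bigD1 (Ordinal (JM : (J < M.+1)%N))) //= big1 ?addr0.
  by rewrite (mulnC p) ltnNge leq_addr addKn -[LHS]mulr_natl.
by move=> i; rewrite -val_eqE => /off ->; rewrite mul0rn.
Qed.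

Lemma sum_ord_mul (A : nmodType) (f : nat -> A) (n p : nat) :
  \sum_(i < n * p) f i = \sum_(J < n) \sum_(j < p) f (J * p + j)%N.
Proof.
elim: n => [|n IH]; first by rewrite !big_ord0.
by rewrite big_ord_recr /= -IH mulSnr big_split_ord.
Qed.

Lemma franel_widen (n N : nat) : (n < N)%N ->
  franel n = (\sum_(j < N) 'C(n, j) ^ 3)%N.
Proof.
move=> nN; rewrite /franel (big_ord_widen N (fun j => 'C(n, j) ^ 3)%N) //.
rewrite big_mkcond; apply: eq_bigr => j _.
by case: ltnP => // nj; rewrite bin_small.
Qed.

(** Both sums are padded with zero terms to full blocks of length [p]; [Lucas] then factors the
    double sum over the digits. *)
Lemma franel_Lucas (A : comNzRingType) (p m M : nat) :
  p \in [pchar A] -> (m < p)%N ->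
  (franel (M * p + m))%:R = (franel M)%:R * (franel m)%:R :> A.
Proof.
move=> cA mp; rewrite (@franel_widen _ (M.+1 * p)); last by rewrite mulSn; lia.
rewrite (@franel_widen m p) // !natr_sum.
rewrite (sum_ord_mul (fun i => ('C(M * p + m, i) ^ 3)%:R)) big_distrl /=.
apply: eq_bigr => J _; rewrite big_distrr /=; apply: eq_bigr => j _.
by rewrite !natrX (Lucas _ _ cA) // exprMn.
Qed.

Lemma franel_half_pow (A : comNzRingType) (p r : nat) :
  p \in [pchar A] -> odd p ->
  (-1) ^+ ((p ^ r - 1) %/ 2) * (franel ((p ^ r - 1) %/ 2))%:R
  = ((-1) ^+ p./2 * (franel p./2)%:R) ^+ r :> A.
Proof.
move=> cA op; have p2 := odd_prime_gt2 op (pcharf_prime cA).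
elim: r => [|r IH].
  by rewrite /= expn0 subnn div0n /franel big_ord1 !expr0 mulr1.
rewrite exprSr -IH.
(* The last base-[p] digit of the index is [p./2]. As [p] is odd, multiplying the other digits by
   [p] does not change their sign contribution. *)
have -> : ((p ^ r.+1 - 1) %/ 2 = (p ^ r - 1) %/ 2 * p + p./2)%N.
  have oX : odd (p ^ r) by rewrite oddX op orbT.
  have E1 : (p ^ r = (p ^ r - 1) %/ 2 * 2 + 1)%N by move: oX; lia.
  rewrite expnSr {1}E1 -divn2; move: ((p ^ r - 1) %/ 2)%N => k.
  have E2 : (p = (p %/ 2) * 2 + 1)%N by move: op; lia.
  by move: (p %/ 2)%N E2 => q ->; nia.
rewrite franel_Lucas //; last by rewrite -divn2; lia.
rewrite exprD -(signr_odd _ (_ * p)) oddM op andbT signr_odd.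
by rewrite mulrACA.
Qed.

(** * Integer coordinates of sums of eighth roots of unity *)

(** On eighth roots of unity this is the coefficient of 1 of the lift to Z[zeta_8], in the basis 1,
    zeta, zeta^2, zeta^3. *)
Definition sgn1 (K : fieldType) (u : K) : int := (u == 1)%:R - (u == -1)%:R.

Section EighthRoots.
Variables (K : fieldType) (z : K).
Hypothesis z_prim : 8.-primitive_root z.

Let z4 : z ^+ 4 = -1.
Proof.
have := prim_expr_order z_prim; rewrite -[8%N]/(4 * 2)%N exprM => /eqP.
rewrite sqrf_eq1 => /orP[|/eqP //].
by rewrite -(prim_order_dvd z_prim).
Qed.

Let z0 : z != 0.
Proof. by apply/eqP => E; move/eqP: z4; rewrite E expr0n /= eq_sym oppr_eq0 oner_eq0. Qed.

Lemma sgn10 : sgn1 (0 : K) = 0.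
Proof. by rewrite /sgn1 eq_sym oner_eq0 eq_sym oppr_eq0 oner_eq0 subrr. Qed.

Lemma sgn1N (u : K) : sgn1 (- u) = - sgn1 u.
Proof. by rewrite /sgn1 eqr_opp eqr_oppLR opprB. Qed.

Let sgn1_pow (j l : nat) : (j < 4)%N -> (l < 4)%N ->
  sgn1 (z ^+ l / z ^+ j) = (l == j)%:R.
Proof.
move=> j4 l4; have zj : z ^+ j != 0 by rewrite expf_neq0.
have E1 : (z ^+ l / z ^+ j == 1) = (z ^+ l == z ^+ j).
  by rewrite -(inj_eq (mulIf zj)) divfK // mul1r.
have E2 : (z ^+ l / z ^+ j == -1) = (z ^+ l == z ^+ (4 + j)).
  by rewrite -(inj_eq (mulIf zj)) divfK // -z4 -exprD.
rewrite /sgn1 E1 E2 !(eq_prim_root_expr z_prim).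
by case: j j4 {zj E1 E2} => [|[|[|[|]]]] // _; case: l l4 => [|[|[|[|]]]].
Qed.

Let root8P (a : K) : a ^+ 8 = 1 ->
  exists2 l : nat, (l < 4)%N & a = z ^+ l \/ a = - z ^+ l.
Proof.
move=> /(prim_rootP z_prim)[[l l8] /= ->].
have [l4|l4] := ltnP l 4; first by exists l => //; left.
exists (l - 4)%N; first by lia.
by right; rewrite -{1}(subnK l4) exprD z4 mulrN1.
Qed.

(** A nonzero [b] is some [z ^+ l] up to sign, so only [j = l] contributes. This is the coordinate
    form of multiplication by the complex conjugate. *)
Let sgn1_sum (a b : K) : b = 0 \/ b ^+ 8 = 1 ->
  \sum_(j < 4) sgn1 (a / z ^+ j) * sgn1 (b / z ^+ j) = sgn1 (a / b).
Proof.
case=> [->|/root8P[l l4 bE]].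
  by rewrite invr0 mulr0 sgn10 big1 // => j _; rewrite mul0r sgn10 mulr0.
have S : \sum_(j < 4) sgn1 (a / z ^+ j) * sgn1 (z ^+ l / z ^+ j) = sgn1 (a / z ^+ l).
  rewrite (bigD1 (Ordinal l4)) //= sgn1_pow // eqxx mulr1 big1 ?addr0 // => j.
  by rewrite -val_eqE /= sgn1_pow // eq_sym => /negPf ->; rewrite mulr0.
case: bE => ->; first exact: S.
rewrite invrN mulrN sgn1N -S -sumrN; apply: eq_bigr => j _.
by rewrite mulNr sgn1N mulrN.
Qed.

(** Cubing exchanges [z] and [z ^+ 3] and sends [z ^+ 2] to [- z ^+ 2]. *)
Let sgn1_cube (a : K) : a = 0 \/ a ^+ 8 = 1 ->
  sgn1 (a ^+ 3 / z ^+ 3) = sgn1 (a / z ^+ 1)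
  /\ sgn1 (a ^+ 3 / z ^+ 2) = - sgn1 (a / z ^+ 2).
Proof.
case=> [->|/root8P[l l4 aE]]; first by rewrite expr0n /= !mul0r sgn10.
have c : z ^+ l ^+ 3 = [:: 1; z ^+ 3; - z ^+ 2; z ^+ 1]`_l.
  rewrite -exprM; case: l l4 {aE} => [|[|[|[|]]]] //= _.
  - by rewrite -[(2 * 3)%N]/(4 + 2)%N exprD z4 mulN1r.
  - by rewrite -[(3 * 3)%N]/(4 + 4 + 1)%N !exprD z4 mulrNN !mul1r.
have T : sgn1 (z ^+ l ^+ 3 / z ^+ 3) = sgn1 (z ^+ l / z ^+ 1)
  /\ sgn1 (z ^+ l ^+ 3 / z ^+ 2) = - sgn1 (z ^+ l / z ^+ 2).
  rewrite c; case: l l4 {aE c} => [|[|[|[|]]]] //= _;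
    rewrite ?mulNr ?sgn1N -?(expr0 z) !sgn1_pow //=.
case: aE => ->; first exact: T.
rewrite exprNn -signr_odd /= expr1 mulN1r !mulNr !sgn1N.
by case: T => -> ->.
Qed.

(** The right side is the reduction of the trace of the lift, which is 4 times its coefficient of
    1. *)
Let sgn1_powsum (a : K) : a = 0 \/ a ^+ 8 = 1 ->
  4 * (sgn1 a)%:~R = a + a ^+ 3 + a ^+ 5 + a ^+ 7.
Proof.
case=> [->|/root8P[l l4 aE]].
  by rewrite sgn10 !expr0n /= mulr0 !addr0.
have T : 4 * (sgn1 (z ^+ l))%:~R
    = z ^+ l + z ^+ l ^+ 3 + z ^+ l ^+ 5 + z ^+ l ^+ 7 :> K.
  have := @sgn1_pow 0 l isT l4; rewrite expr0 divr1 => ->.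
  case: l l4 {aE} => [|[|[|[|]]]] //= _.
  - by rewrite expr0 !expr1n mulr1; ring.
  - by rewrite mulr0; ring: z4.
  - by rewrite mulr0; ring: z4.
  - by rewrite mulr0; ring: z4.
case: aE => ->; first exact: T.
by rewrite sgn1N rmorphN mulrN T; ring.
Qed.

(* Lift [z] to a complex 8th root of unity and [w] accordingly. The sum of the
   lifts is [n 0 + n 1 z + n 2 z^2 + n 3 z^3], where [n j] is the number of [x]
   with [w x = z ^+ j] minus the number of those with [w x = - z ^+ j]. The
   symmetry [w -> w ^+ 3] puts this sum in Z[sqrt(-2)], and the last hypothesis
   says that its norm is [P]. Working with the [n j] avoids the lift. *)
Lemma norm_form_of_eighth_roots (X : finType) (w : X -> K) (s : X -> X) (P : int) :
  (forall x, w x = 0 \/ w x ^+ 8 = 1) ->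
  injective s -> (forall x, w (s x) = w x ^+ 3) ->
  \sum_x \sum_y sgn1 (w x / w y) = P ->
  exists c d : int, P = c ^+ 2 + 2 * d ^+ 2 /\
    2 * c%:~R = \sum_x w x + \sum_x w x ^+ 5.
Proof.
move=> wU s_inj ws sP; pose n (j : nat) := \sum_x sgn1 (w x / z ^+ j).
have sn j : n j = \sum_x sgn1 (w x ^+ 3 / z ^+ j).
  by rewrite /n (reindex_inj s_inj); apply: eq_bigr => x _; rewrite ws.
have n31 : n 3%N = n 1%N.
  by rewrite sn; apply: eq_bigr => x _; case: (sgn1_cube (wU x)).
have n2 : n 2%N = 0.
  suff : n 2%N = - n 2%N by lia.
  by rewrite {1}sn -sumrN; apply: eq_bigr => x _; case: (sgn1_cube (wU x)).
(* The lifted sum is n 0 + n 1 (z + z^3), and z + z^3 is a square root of -2. *)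
exists (n 0%N), (n 1%N); split; last first.
  have two0 : 2 != 0 :> K.
    by rewrite -[2%:R]/(1 + 1) addr_eq0 -z4 eq_sym -(prim_order_dvd z_prim).
  have w3 : \sum_x w x ^+ 3 = \sum_x w x.
    by rewrite [RHS](reindex_inj s_inj); apply: eq_bigr => x _; rewrite ws.
  have w7 : \sum_x w x ^+ 7 = \sum_x w x ^+ 5.
    rewrite [RHS](reindex_inj s_inj); apply: eq_bigr => x _; rewrite ws -exprM.
    case: (wU x) => [->|E]; first by rewrite !expr0n.
    by rewrite (_ : 3 * 5 = 8 + 7)%N // exprD E mul1r.
  have E : 4 * (n 0%N)%:~R = \sum_x (w x + w x ^+ 3 + w x ^+ 5 + w x ^+ 7).
    rewrite /n raddf_sum mulr_sumr; apply: eq_bigr => x _.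
    by rewrite expr0 divr1 sgn1_powsum.
  apply: (mulfI two0); rewrite mulrA -natrM E !big_split /= w3 w7.
  by ring.
(* By [sgn1_sum] the double sum is the squared length of the coordinate vector. *)
transitivity (\sum_(j < 4) n j ^+ 2).
  rewrite -sP; under [RHS]eq_bigr => j _ do rewrite expr2 {1}/n big_distrl /=.
  rewrite [RHS]exchange_big /=; apply: eq_bigr => x _.
  under [RHS]eq_bigr => j _ do rewrite /n big_distrr /=.
  rewrite [RHS]exchange_big /=.
  by apply: eq_bigr => y _; rewrite sgn1_sum.
by rewrite !big_ord_recr big_ord0 /= n31 n2; ring.
Qed.

End EighthRoots.

(** * Power sums and binomials over finite fields *)

Lemma intr_pchar_eq0 (A : nzRingType) (p : nat) (x : int) :
  p \in [pchar A] -> (x%:~R == 0 :> A) = (p %| x)%Z.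
Proof.
move=> cA; rewrite -[(p %| x)%Z]/(p %| `|x|)%N (dvdn_pcharf cA).
by case: (intP x) => [|n|n] /=; rewrite ?mulrNz ?oppr_eq0 ?abszN.
Qed.

Lemma finField_prim_root (K : finFieldType) :
  exists g : K, #|K|.-1.-primitive_root g.
Proof.
have K0 : (0 < #|K|.-1)%N by have := finNzRing_gt1 K; case: #|K| => [|[]].
have /hasP[g _ gP] : has #|K|.-1.-primitive_root (enum (predC1 (0 : K))).
  apply: has_prim_root => //.
  - apply/allP => x; rewrite mem_enum inE => x0; rewrite unity_rootE.
    rewrite -(inj_eq (mulfI x0)) mulr1 -exprS prednK ?expf_card //.
    exact: ltnW (finNzRing_gt1 K).
  - exact: enum_uniq.
  by rewrite -cardE cardC1.
by exists g.
Qed.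

Lemma expf_card_pred (K : finFieldType) (x : K) : x != 0 -> x ^+ #|K|.-1 = 1.
Proof.
move=> x0; apply: (mulfI x0); rewrite -exprS mulr1 prednK ?expf_card //.
exact: ltnW (finNzRing_gt1 K).
Qed.

(** Scaling by a generator [g] multiplies the sum by [g ^+ n], which is not 1. *)
Lemma sum_expr_eq0 (K : finFieldType) (n : nat) : ~~ (#|K|.-1 %| n)%N ->
  \sum_(x : K) x ^+ n = 0.
Proof.
move=> dn; have [g gP] := finField_prim_root K.
have g0 : g != 0.
  have := prim_expr_order gP; have := prim_order_gt0 gP.
  case: #|K|.-1 => // k _ E; apply/eqP => g0; move/eqP: E.
  by rewrite g0 expr0n eq_sym oner_eq0.
have E : \sum_(x : K) x ^+ n = g ^+ n * \sum_(x : K) x ^+ n.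
  rewrite {1}(reindex_inj (mulfI g0)) mulr_sumr.
  by apply: eq_bigr => x _; rewrite exprMn.
have : (g ^+ n - 1) * \sum_(x : K) x ^+ n = 0 by rewrite mulrBl mul1r -E subrr.
move/eqP; rewrite mulf_eq0 subr_eq0 -(prim_order_dvd gP) (negPf dn) /=.
by move/eqP.
Qed.

Lemma sum_expr_eqN1 (K : finFieldType) (n : nat) : (0 < n)%N ->
  (#|K|.-1 %| n)%N -> \sum_(x : K) x ^+ n = -1.
Proof.
move=> n0 /dvdnP[k kE].
rewrite (bigD1 0) //= expr0n gtn_eqF // add0r.
rewrite (eq_bigr (fun=> 1)); last first.
  by move=> x x0; rewrite kE mulnC exprM expf_card_pred ?expr1n.
rewrite sumr_const cardC1; apply/eqP; rewrite -addr_eq0 natr1 prednK.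
  (* Translating the sum of all elements by 1 shows that [#|K|] is 0 in [K]. *)
  have : \sum_(x : K) x = \sum_(x : K) x + #|K|%:R.
    rewrite {1}(reindex_inj (addIr 1)) big_split /= sumr_const.
    by congr (_ + _%:R).
  by move/eqP; rewrite -[X in X == _]addr0 (inj_eq (addrI _)) eq_sym.
exact: ltnW (finNzRing_gt1 K).
Qed.

(** In [A] the upper index [p.-1 - a] equals [-1 - a], so this is upper negation of binomials. *)
Lemma bin_reflect_pchar (A : fieldType) (p a k : nat) :
  p \in [pchar A] -> (a + k < p)%N ->
  'C(p.-1 - a, k)%:R = (-1) ^+ k * 'C(a + k, k)%:R :> A.
Proof.
move=> cA; elim: k => [|k IH] akp; first by rewrite !bin0 expr0 mulr1.
have d1 : k.+1%:R != 0 :> A by apply: (natr_pchar_neq0 cA); lia.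
apply: (mulfI d1); rewrite natr_bin_left IH; last by lia.
rewrite addnS [RHS]mulrCA natr_bin_diag exprS.
have -> : (p.-1 - a)%:R - k%:R = - (a + k).+1%:R :> A.
  rewrite -natrB; last by lia.
  apply/eqP; rewrite -addr_eq0 -natrD -(dvdn_pcharf cA).
  by rewrite (_ : _ + _ = p)%N //; lia.
by rewrite mulrCA mulN1r !mulNr mulrN.
Qed.

(** Serves as orthogonality of characters: [h] will be an element where the character takes the
    value -1. *)
Lemma sum_sgn1_odd (K : finFieldType) (f : K -> K) (h : K) : h != 0 ->
  (forall b, f (h * b) = - f b) -> \sum_b sgn1 (f b) = 0.
Proof.
move=> h0 fh; have : \sum_b sgn1 (f b) = - \sum_b sgn1 (f b); last by lia.
rewrite {1}(reindex_inj (mulfI h0)) -sumrN.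
by apply: eq_bigr => b _; rewrite fh sgn1N.
Qed.

(* For [p = 8 e + 1] the sum of the [w x] is a Jacobi sum of two characters of
   order 8. *)
Section JacobiSum.
Variables (K : finFieldType) (p e : nat).
Hypotheses (cK : p \in [pchar K]) (oK : #|K| = p) (pE : p = (8 * e).+1).

(** With [x ^+ e] as character of order 8, the exponents 1 and 3 make [x -> 1 - x] act on [w] as
    cubing, since 9 = 1 mod 8. *)
Let w (x : K) : K := x ^+ e * (1 - x) ^+ (3 * e).

Let e0 : (0 < e)%N.
Proof. by have := prime_gt1 (pcharf_prime cK); rewrite pE; lia. Qed.

Let ord8 (x : K) : x != 0 -> x ^+ (8 * e) = 1.
Proof. by move=> x0; have := expf_card_pred x0; rewrite oK pE. Qed.

Let wU (x : K) : w x = 0 \/ w x ^+ 8 = 1.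
Proof.
rewrite /w; have [->|x0] := eqVneq x 0; first by rewrite expr0n gtn_eqF // mul0r; left.
have [/eqP|x1] := eqVneq (1 - x) 0.
  by move=> /eqP ->; rewrite [0 ^+ (_ * _)]expr0n gtn_eqF ?muln_gt0 // mulr0; left.
right; rewrite exprMn -!exprM (mulnC e) (_ : 3 * e * 8 = 8 * e * 3)%N.
  by rewrite ord8 // mul1r exprM ord8 ?expr1n.
by lia.
Qed.

Let w_sym (x : K) : w (1 - x) = w x ^+ 3.
Proof.
rewrite /w subKr exprMn -!exprM (mulnC e) [LHS]mulrC; congr (_ * _).
have -> : (3 * e * 3 = 8 * e + e)%N by lia.
rewrite exprD; have [->|x1] := eqVneq (1 - x) 0.
  by rewrite !expr0n !gtn_eqF ?mulr0 // !muln_gt0 e0.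
by rewrite ord8 ?mul1r.
Qed.

Let w_inj : injective (fun x : K => 1 - x).
Proof. by move=> x y /addrI/oppr_inj. Qed.

(* [y |-> (1 - a y) / (1 - y)] is a bijection from the [y] distinct from 0
   and 1 to the [b] distinct from 1 and [a]. *)
Let corr_line (a : K) : a != 0 -> a != 1 ->
  \sum_(y | (y != 0) && (y != 1)) sgn1 (w (a * y) / w y)
  = (\sum_b sgn1 (a ^+ e * b ^+ (3 * e))) - sgn1 (a ^+ e) - sgn1 (a ^+ (4 * e)).
Proof.
move=> a0 a1.
rewrite (reindex_onto (fun b => (b - 1) / (b - a)) (fun y => (1 - a * y) / (1 - y))).
  have -> : \sum_b sgn1 (a ^+ e * b ^+ (3 * e)) = sgn1 (a ^+ e) +
      (sgn1 (a ^+ (4 * e)) +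
       \sum_(b | (b != 1) && (b != a)) sgn1 (a ^+ e * b ^+ (3 * e))).
    rewrite (bigD1 1) //= (bigD1 a) //= expr1n mulr1 -exprD.
    by rewrite (_ : e + 3 * e = 4 * e)%N //; lia.
  rewrite [RHS](_ : _ =
    \sum_(b | (b != 1) && (b != a)) sgn1 (a ^+ e * b ^+ (3 * e))); last by ring.
  apply: eq_big => [b|b /andP[/andP[]]].
    have [->|b1] := eqVneq b 1; first by rewrite subrr mul0r eqxx.
    have [->|ba] := eqVneq b a; first by rewrite subrr invr0 mulr0 eqxx.
    have d1 : b - 1 != 0 by rewrite subr_eq0.
    have d2 : b - a != 0 by rewrite subr_eq0.
    have d3 : 1 - a != 0 by rewrite subr_eq0 eq_sym.
    have E : 1 - (b - 1) / (b - a) = (1 - a) / (b - a) by field.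
    rewrite mulf_neq0 ?invr_eq0 // [_ == 1]eq_sym -subr_eq0 E.
    rewrite mulf_neq0 ?invr_eq0 //=; apply/eqP; field.
    by rewrite d2 d3.
  move: ((b - 1) / (b - a)) => y y0 y1 /eqP E.
  have d1 : 1 - y != 0 by rewrite subr_eq0 eq_sym.
  rewrite /w (_ : 1 - a * y = b * (1 - y)) ?exprMn; last by rewrite -E divfK.
  congr (sgn1 _); have d2 : y ^+ e != 0 by rewrite expf_neq0.
  have d3 : (1 - y) ^+ (3 * e) != 0 by rewrite expf_neq0.
  by field; rewrite d2 d3.
move=> y /andP[y0 y1].
have d1 : 1 - y != 0 by rewrite subr_eq0 eq_sym.
have d2 : 1 - a != 0 by rewrite subr_eq0 eq_sym.
have E1 : (1 - a * y) / (1 - y) - 1 = y * (1 - a) / (1 - y) by field.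
have E2 : (1 - a * y) / (1 - y) - a = (1 - a) / (1 - y) by field.
by rewrite E1 E2; field; rewrite d1 d2.
Qed.

(** Put [x = a * y] and sum over [a]. The term [a = 1] gives [p - 2]. For the other nonzero [a] the
    character sum in [corr_line] vanishes, and the two subtracted terms add up to 2 over all such
    [a]. *)
Lemma jacobi_corr : \sum_x \sum_y sgn1 (w x / w y) = p%:Z.
Proof.
have [g gP] := finField_prim_root K; rewrite oK pE /= in gP.
have g0 : g != 0.
  apply/eqP => g0; have := prim_expr_order gP.
  rewrite g0 expr0n gtn_eqF ?muln_gt0 ?e0 // => /eqP.
  by rewrite eq_sym oner_eq0.
(* Supplies the sign change for [sum_sgn1_odd]: by [g ^+ 4] for the powers [e] and [3 * e], by [g]
   for the power [4 * e]. *)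
have g4e : g ^+ (4 * e) = -1.
  have /eqP : (g ^+ (4 * e)) ^+ 2 = 1.
    by rewrite -exprM (_ : 4 * e * 2 = 8 * e)%N ?(prim_expr_order gP) //; lia.
  rewrite sqrf_eq1 -(prim_order_dvd gP) gtnNdvd /=; first by move/eqP.
    by rewrite muln_gt0 e0.
  by rewrite ltn_mul2r e0.
have S1 : \sum_(a : K) sgn1 (a ^+ e) = 0.
  apply: (@sum_sgn1_odd _ (fun a => a ^+ e) (g ^+ 4)) => [|b].
    by rewrite expf_neq0.
  by rewrite exprMn -exprM g4e mulN1r.
have S2 : \sum_(a : K) sgn1 (a ^+ (4 * e)) = 0.
  apply: (@sum_sgn1_odd _ (fun a => a ^+ (4 * e)) g) => // b.
  by rewrite exprMn g4e mulN1r.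
have S3 (a : K) : \sum_(b : K) sgn1 (a ^+ e * b ^+ (3 * e)) = 0.
  apply: (@sum_sgn1_odd _ (fun b => a ^+ e * b ^+ (3 * e)) (g ^+ 4)) => [|b].
    by rewrite expf_neq0.
  rewrite exprMn -exprM (_ : 4 * (3 * e) = 4 * e * 3)%N; last by lia.
  by rewrite exprM g4e -signr_odd expr1 mulN1r mulrN.
have w0 : w 0 = 0 by rewrite /w expr0n gtn_eqF // mul0r.
have w1 : w 1 = 0 by rewrite /w subrr [0 ^+ (_ * _)]expr0n gtn_eqF ?muln_gt0 // mulr0.
transitivity (\sum_a \sum_(y | (y != 0) && (y != 1)) sgn1 (w (a * y) / w y)).
  rewrite exchange_big [RHS]exchange_big /= [RHS]big_mkcond.
  apply: eq_bigr => y _; case: ifP.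
    by move=> /andP[y0 y1]; rewrite (reindex_inj (mulIf y0)).
  move=> /negbT; rewrite negb_and !negbK => /orP[]/eqP ->.
    by rewrite big1 // => x _; rewrite w0 invr0 mulr0 sgn10.
  by rewrite big1 // => x _; rewrite w1 invr0 mulr0 sgn10.
rewrite (bigD1 0) //= big1 ?add0r; last first.
  by move=> y _; rewrite mul0r w0 mul0r sgn10.
rewrite (bigD1 1) ?oner_eq0 //=.
rewrite [X in _ + X](eq_bigr
  (fun a => - (sgn1 (a ^+ e) + sgn1 (a ^+ (4 * e))))); last first.
  by move=> a /andP[a0 a1]; rewrite corr_line // S3; ring.
rewrite sumrN [X in _ - X]big_split /=.
have S (f : K -> int) : \sum_(a : K) f a = 0 ->
    \sum_(a | (a != 0) && (a != 1)) f a = - f 0 - f 1.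
  rewrite (bigD1 0) //= (bigD1 1) ?oner_eq0 //= addrA addrC => /eqP.
  by rewrite addr_eq0 opprD => /eqP.
have /= -> := S _ S1; have /= -> := S _ S2; rewrite !expr0n !gtn_eqF ?muln_gt0 ?e0 // sgn10 !expr1n.
have s1 : sgn1 (1 : K) = 1.
  rewrite /sgn1 eqxx (_ : (1 == -1 :> K) = false) // -addr_eq0.
  apply/negbTE; rewrite -[1 + 1]/(2%:R); apply: (natr_pchar_neq0 cK).
  by rewrite pE; lia.
rewrite s1 (eq_bigr (fun=> 1)); last first.
  move=> y /andP[y0 y1]; rewrite mul1r divff //.
  by rewrite mulf_neq0 ?expf_neq0 // subr_eq0 eq_sym.
rewrite sumr_const.
have : #|[pred y : K | (y != 0) && (y != 1)]| = p.-2.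
  rewrite -oK [in RHS](cardD1 (0 : K)) [in RHS](cardD1 (1 : K)) !inE /= oner_eq0 /=.
  by apply: eq_card => y; rewrite !inE andbT andbC.
move=> ->; rewrite pE; lia.
Qed.

Lemma sum_expr_beta (a b : nat) :
  \sum_(x : K) x ^+ a * (1 - x) ^+ b
  = \sum_(k < b.+1) (-1) ^+ k * 'C(b, k)%:R * \sum_(x : K) x ^+ (a + k).
Proof.
transitivity (\sum_(x : K) \sum_(k < b.+1) (-1) ^+ k * 'C(b, k)%:R * x ^+ (a + k)).
  apply: eq_bigr => x _; rewrite exprDn big_distrr /=; apply: eq_bigr => k _.
  by rewrite expr1n mul1r (exprNn x) exprD -[X in _ * X]mulr_natr; ring.
by rewrite exchange_big; apply: eq_bigr => k _; rewrite mulr_sumr.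
Qed.

Lemma jacobi_norm_form : exists c d : int,
  p%:Z = c ^+ 2 + 2 * d ^+ 2 /\ 2 * c%:~R = - 'C(4 * e, e)%:R :> K.
Proof.
have [g gP] := finField_prim_root K; rewrite oK pE /= in gP.
have zP : 8.-primitive_root (g ^+ e).
  by have := dvdn_prim_root gP (dvdn_mulr e (dvdnn 8)); rewrite mulKn.
have [c [d [E1 E2]]] := norm_form_of_eighth_roots zP wU w_inj w_sym jacobi_corr.
exists c, d; split => //.
(* All exponents lie strictly between 0 and [8 * e]. *)
have S1 : \sum_x w x = 0.
  rewrite sum_expr_beta // big1 // => k _; rewrite sum_expr_eq0 ?mulr0 // oK pE /=.
  by rewrite gtnNdvd //; have := ltn_ord k; lia.
have S5 : \sum_x w x ^+ 5 = - 'C(4 * e, e)%:R.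
  transitivity (\sum_(x : K) x ^+ (5 * e) * (1 - x) ^+ (7 * e)).
    apply: eq_bigr => x _; rewrite /w exprMn -!exprM (mulnC e); congr (_ * _).
    have -> : (3 * e * 5 = 8 * e + 7 * e)%N by lia.
    rewrite exprD.
    have [->|x1] := eqVneq (1 - x) 0; last by rewrite ord8 ?mul1r.
    by rewrite !expr0n !gtn_eqF ?mulr0 // !muln_gt0 e0.
  (* The exponents [5 * e + k] run from [5 * e] to [12 * e]; the only multiple of [8 * e] among them
     occurs at [k = 3 * e]. *)
  have l3 : (3 * e < (7 * e).+1)%N by lia.
  rewrite sum_expr_beta // (bigD1 (Ordinal l3)) //= [X in _ + X]big1 ?addr0.
    rewrite sum_expr_eqN1 ?oK ?pE /=; first last.
    - by rewrite (_ : 5 * e + 3 * e = 8 * e)%N //; lia.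
    - by lia.
    rewrite mulrN1 (_ : 7 * e = p.-1 - e)%N; last by rewrite pE; lia.
    rewrite (bin_reflect_pchar cK); last by rewrite pE; lia.
    rewrite signrMK (_ : e + 3 * e = 4 * e)%N; last by lia.
    have l4 : (3 * e <= 4 * e)%N by lia.
    by rewrite -(bin_sub l4); congr (- 'C(_, _)%:R); lia.
  move=> k; rewrite -val_eqE /= => k3; rewrite sum_expr_eq0 ?mulr0 // oK pE /=.
  apply/negP => /dvdnP[t tE]; have := ltn_ord k.
  have [t1|t1] : (t <= 1 \/ 2 <= t)%N by lia.
    by case: t t1 tE => [|[|]] // _ tE; lia.
  by nia.
by rewrite E2 S1 S5 add0r.
Qed.

End JacobiSum.

(* For [p = 8 e + 3] the characters of order 8 live on the field with [p ^ 2]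
   elements, and the Jacobi sum is replaced by an Eisenstein sum over the line
   [L] of elements of trace 2; [F] is the prime field. *)
Section EisensteinSum.
Variables (K : finFieldType) (p e : nat).
Hypotheses (cK : p \in [pchar K]) (oK : #|K| = (p ^ 2)%N) (pE : p = (8 * e + 3)%N).

(** [h] is (p^2 - 1) / 8, so that [x ^+ h] is a character of order 8 on [K]; [m] is (p - 1) / 2. *)
Let h : nat := (8 * e ^ 2 + 6 * e + 1)%N.
Let m : nat := (4 * e + 1)%N.

Let qE : #|K|.-1 = (8 * h)%N.
Proof. by rewrite oK pE /h; nia. Qed.

Let h0 : (0 < h)%N. Proof. by rewrite /h addn1. Qed.

Let odd_h : odd h.
Proof. by rewrite /h addn1 /= oddD (oddM 8) (oddM 6). Qed.

Let ord8 (x : K) : x != 0 -> x ^+ (8 * h) = 1.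
Proof. by rewrite -qE => /expf_card_pred. Qed.

Let two0 : 2 != 0 :> K.
Proof. by apply: (natr_pchar_neq0 cK); rewrite pE; lia. Qed.

Let barD (x y : K) : (x + y) ^+ p = x ^+ p + y ^+ p.
Proof. by rewrite exprDn_pchar // pnatE ?(pcharf_prime cK). Qed.

Let barN (x : K) : (- x) ^+ p = - x ^+ p.
Proof.
by rewrite exprNn -signr_odd pE oddD oddM expr1 mulN1r.
Qed.

Let barK (x : K) : (x ^+ p) ^+ p = x.
Proof. by rewrite -exprM mulnn -oK expf_card. Qed.

Let bar2 : 2 ^+ p = 2 :> K.
Proof. by rewrite -(pFrobenius_autE cK) pFrobenius_aut_nat. Qed.

Let p0 : (0 < p)%N. Proof. by rewrite pE addn3. Qed.

Let L (x : K) := x + x ^+ p == 2.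
Let F (x : K) := x ^+ p == x.
Let w (x : K) : K := if L x then x ^+ h else 0.

Let L_neq0 (x : K) : L x -> x != 0.
Proof.
rewrite /L; apply: contraTneq => ->.
by rewrite expr0n gtn_eqF // addr0 eq_sym.
Qed.

Let wU (x : K) : w x = 0 \/ w x ^+ 8 = 1.
Proof.
rewrite /w; case: ifP => [Lx|_]; last by left.
by right; rewrite -exprM mulnC ord8 ?L_neq0.
Qed.

Let bar_inj : injective (fun x : K => x ^+ p).
Proof. by move=> x y E; rewrite -(barK x) -(barK y) E. Qed.

(** Conjugation [x ^+ p] preserves the trace and hence [L]; as [p] is 3 mod 8, it cubes the
    character. *)
Let w_sym (x : K) : w (x ^+ p) = w x ^+ 3.
Proof.
rewrite /w (_ : L (x ^+ p) = L x); last by rewrite /L barK addrC.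
case: ifP => [Lx|_]; last by rewrite expr0n.
rewrite -!exprM (_ : p * h = 8 * h * e + h * 3)%N; last by rewrite pE; lia.
by rewrite exprD exprM ord8 ?L_neq0 // expr1n mul1r.
Qed.

Let zP : exists z : K, 8.-primitive_root z.
Proof.
have [g gP] := finField_prim_root K; rewrite qE in gP; exists (g ^+ h).
by have := dvdn_prim_root gP (dvdn_mulr h (dvdnn 8)); rewrite mulKn.
Qed.

Let card_LF : #|L| = #|F|.
Proof.
have [z z8] := zP; pose i := z ^+ 2.
have i2 : i ^+ 2 = -1.
  have := prim_expr_order z8; rewrite -[8%N]/(2 * 2 * 2)%N exprM => /eqP.
  rewrite sqrf_eq1 -exprM => /orP[|/eqP //].
  by rewrite -(prim_order_dvd z8).
have i0 : i != 0.
  by apply/eqP => E; move/eqP: i2; rewrite E expr0n /= eq_sym oppr_eq0 oner_eq0.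
have ip : i ^+ p = - i.
  rewrite pE (_ : 8 * e + 3 = 2 * (4 * e + 1) + 1)%N; last by lia.
  by rewrite exprD exprM i2 -signr_odd oddD oddM /= expr1 mulN1r expr1.
have f_inj : injective (fun a => 1 + i * a) by move=> a b /addrI/(mulfI i0).
rewrite -(fintype.card_image f_inj F); apply: eq_card => x.
apply/idP/fintype.imageP => [Lx|[a Fa ->]].
  exists ((x - 1) / i); last by rewrite mulrC divfK // addrC subrK.
  change (F ((x - 1) / i)); rewrite /F exprMn exprVn ip barD barN expr1n.
  have /eqP L' : L x := Lx.
  have -> : x ^+ p = 2 - x by rewrite -L' addrC addKr.
  by apply/eqP; field; rewrite ?oppr_eq0 ?i0.
have /eqP F' : F a := Fa.
by change (L (1 + i * a)); rewrite /L barD exprMn ip F' expr1n; apply/eqP; ring.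
Qed.

(** The number of ways to write [u] as a quotient of two elements of [L]. *)
Let N (u : K) : nat := #|[pred y | L y && L (u * y)]|.

Let N_notF (u : K) : ~~ F u -> N u = 1%N.
Proof.
rewrite /F => Fu; have d : u - u ^+ p != 0 by rewrite subr_eq0 eq_sym.
(* Cramer's rule for y + y^p = 2 and u y + u^p y^p = 2, in the unknowns y and y^p. *)
pose y0 := 2 * (1 - u ^+ p) / (u - u ^+ p).
rewrite /N -(card1 y0); apply: eq_card => y; rewrite !inE.
apply/andP/eqP => [[/eqP L1 /eqP L2]|->].
  apply: (mulIf d); rewrite /y0 divfK //.
  have E : y ^+ p = 2 - y by rewrite -L1 addrC addKr.
  rewrite exprMn E in L2.
  transitivity (u * y + u ^+ p * (2 - y) - 2 * u ^+ p); first by ring.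
  by rewrite L2; ring.
have E : y0 ^+ p = 2 * (1 - u) / (u ^+ p - u).
  by rewrite /y0 !exprMn exprVn bar2 !barD !barN barK expr1n.
rewrite /L [(u * y0) ^+ p]exprMn E /y0.
have d' : u ^+ p - u != 0 by rewrite subr_eq0.
by split; apply/eqP; field; rewrite d d'.
Qed.

Let N_F (u : K) : F u -> u != 1 -> N u = 0%N.
Proof.
move=> Fu u1; apply: eq_card0 => y; rewrite !inE; apply/negP.
move=> /andP[/eqP L1 /eqP]; rewrite exprMn (eqP Fu) -mulrDr L1 => /eqP.
rewrite -subr_eq0 -[X in _ - X]mul1r -mulrBl mulf_eq0 subr_eq0.
by rewrite (negPf u1) (negPf two0).
Qed.

Let N1 : N 1 = #|L|.
Proof. by apply: eq_card => y; rewrite !inE mul1r andbb. Qed.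

Let F1 : F 1. Proof. by rewrite /F expr1n. Qed.

Let sum_N (f : K -> int) :
  \sum_u f u *+ N u = \sum_(u | ~~ F u) f u + f 1 *+ #|L|.
Proof.
rewrite (bigID F) /= addrC; congr (_ + _).
  by apply: eq_bigr => u /N_notF ->.
rewrite (bigD1 1) //= N1 big1 ?addr0 // => u /andP[Fu u1].
by rewrite N_F.
Qed.

Let sum_pairs (f : K -> int) :
  \sum_(x | L x) \sum_(y | L y) f (x / y) = \sum_u f u *+ N u.
Proof.
rewrite exchange_big /=.
transitivity (\sum_(y | L y) \sum_(u | L (u * y)) f u).
  apply: eq_bigr => y Ly; have y0 := L_neq0 Ly.
  rewrite (reindex_inj (mulIf y0)); apply: eq_bigr => u _.
  by rewrite mulfK.
rewrite (exchange_big_dep xpredT) //=; apply: eq_bigr => u _.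
by rewrite sumr_const.
Qed.

(** Counting pairs in [L] by their quotient gives #|L|^2 = #|K| - #|F| + #|L|, which is p^2. *)
Let card_L : #|L| = p.
Proof.
have := sum_pairs (fun=> 1); rewrite sum_N !sumr_const -mulrnDr.
rewrite -mulrnA => /eqP.
have -> : (#|[pred u | ~~ F u]| + #|L| = p ^ 2)%N.
  by rewrite card_LF -oK -(cardC F) addnC; congr (_ + _)%N; apply: eq_card.
by rewrite eqr_nat mulnn eqn_exp2r // => /eqP.
Qed.

(** Group the pairs by their quotient. Quotients outside [F] occur once each and cancel against
    their negatives, [h] being odd; inside [F] only 1 occurs, [#|L|] times. *)
Let eisenstein_corr : \sum_x \sum_y sgn1 (w x / w y) = p%:Z.
Proof.
transitivity (\sum_(x | L x) \sum_(y | L y) sgn1 ((x / y) ^+ h)).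
  rewrite [RHS]big_mkcond; apply: eq_bigr => x _; rewrite /w.
  case: ifP => Lx; last by rewrite big1 // => y _; rewrite mul0r sgn10.
  rewrite [RHS]big_mkcond; apply: eq_bigr => y _.
  by case: ifP => _; rewrite ?invr0 ?mulr0 ?sgn10 // exprMn exprVn.
rewrite (sum_pairs (fun u => sgn1 (u ^+ h))) sum_N expr1n.
have -> : sgn1 (1 : K) = 1.
  by rewrite /sgn1 eqxx -addr_eq0 (negPf two0).
have : \sum_(u | ~~ F u) sgn1 (u ^+ h) = - \sum_(u | ~~ F u) sgn1 (u ^+ h).
  rewrite {1}(reindex_inj oppr_inj) /= -sumrN; apply: eq_big => u.
    by rewrite /F barN eqr_opp.
  by move=> _; rewrite exprNn -signr_odd odd_h expr1 mulN1r sgn1N.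
move=> E; have -> : \sum_(u | ~~ F u) sgn1 (u ^+ h) = 0 by lia.
by rewrite add0r card_L natz.
Qed.

(* The summand is homogeneous of degree 0 under scaling by the prime field, so
   that summing over all of [K] amounts to summing over the line [L]. *)
Let powsum (j : nat) : odd j ->
  \sum_(x : K) (x + x ^+ p) ^+ m * x ^+ (j * h)
  = - (2 ^+ m * \sum_(x | L x) x ^+ (j * h)).
Proof.
move=> oj; pose T (x : K) := (x + x ^+ p) / 2.
rewrite (partition_big T xpredT) //=.
(* Split by the half trace [l]: values outside [F] are not attained, and [l = 0] kills the factor
   [(x + x ^+ p) ^+ m]. *)
transitivity (\sum_(l | F l && (l != 0)) 2 ^+ m * \sum_(x | L x) x ^+ (j * h)).
  rewrite [RHS]big_mkcond; apply: eq_bigr => l _; case: ifP; last first.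
    move=> /negbT; rewrite negb_and negbK => /orP[Fl|/eqP ->].
      rewrite big_pred0 // => x; apply/negP => /eqP Tx; case/negP: Fl.
      by rewrite -Tx /F /T exprMn exprVn bar2 barD barK addrC.
    rewrite big1 // => x; rewrite /T mulf_eq0 invr_eq0 (negPf two0) orbF => /eqP ->.
    by rewrite expr0n gtn_eqF ?mul0r // /m addn1.
  move=> /andP[/eqP Fl l0]; rewrite (reindex_inj (mulfI l0)) mulr_sumr /=.
  apply: eq_big => x.
    rewrite /T exprMn Fl -mulrDr -mulrA -[X in _ == X]mulr1 (inj_eq (mulfI l0)).
    by rewrite -(inj_eq (mulIf two0)) divfK // mul1r.
  rewrite /T exprMn Fl -mulrDr -mulrA -[X in _ == X]mulr1 (inj_eq (mulfI l0)).
  rewrite -(inj_eq (mulIf two0)) divfK // mul1r => /eqP ->.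
  (* As h = m (2e + 1) and p - 1 = 2m, the exponent is a multiple of p - 1 for odd [j]. *)
  have l1 : l ^+ (m + j * h) = 1.
    have lp : l ^+ p.-1 = 1.
      by apply: (mulfI l0); rewrite -exprS prednK // Fl mulr1.
    have [t ->] : exists t, j = t.*2.+1.
      by exists j./2; rewrite -[LHS]odd_double_half oj.
    have -> : (m + t.*2.+1 * h = p.-1 * (t * (2 * e + 1) + e + 1))%N.
      by rewrite pE /m /h; nia.
    by rewrite exprM lp expr1n.
  rewrite !exprMn -(mul1r (2 ^+ m * _)) -l1 exprD; ring.
rewrite sumr_const -[RHS]mulN1r.
have -> : #|[pred l | F l & l != 0]| = p.-1.
  have F0 : 0 \in F by change (F 0); rewrite /F expr0n gtn_eqF.
  rewrite -[in RHS]card_L card_LF (cardD1 0 F) F0 /=.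
  by apply: eq_card => l; rewrite !inE andbC.
rewrite -[LHS]mulr_natl; congr (_ * _); apply/eqP.
by rewrite -addr_eq0 natr1 prednK // -(dvdn_pcharf cK).
Qed.

Let powsum_bin (j : nat) :
  \sum_(x : K) (x + x ^+ p) ^+ m * x ^+ (j * h)
  = \sum_(k < m.+1) 'C(m, k)%:R * \sum_(x : K) x ^+ (m - k + p * k + j * h).
Proof.
transitivity (\sum_(x : K) \sum_(k < m.+1)
    'C(m, k)%:R * x ^+ (m - k + p * k + j * h)).
  apply: eq_bigr => x _; rewrite exprDn big_distrl /=; apply: eq_bigr => k _.
  have -> : x ^+ (m - k + p * k + j * h)
      = x ^+ (m - k) * (x ^+ p) ^+ k * x ^+ (j * h).
    by rewrite -exprM -!exprD.
  by rewrite -[X in X * _ = _]mulr_natl !mulrA.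
by rewrite exchange_big; apply: eq_bigr => k _; rewrite mulr_sumr.
Qed.

Lemma eisenstein_norm_form : exists c d : int,
  p%:Z = c ^+ 2 + 2 * d ^+ 2 /\ 2 ^+ m * (2 * c%:~R) = 'C(m, e)%:R :> K.
Proof.
have [z z8] := zP.
have [c [d [E1 E2]]] :=
  norm_form_of_eighth_roots z8 wU bar_inj w_sym eisenstein_corr.
exists c, d; split => //.
have wj j : (0 < j)%N -> \sum_x w x ^+ j = \sum_(x | L x) x ^+ (j * h).
  move=> j0; rewrite [RHS]big_mkcond; apply: eq_bigr => x _; rewrite /w.
  by case: ifP => _; rewrite ?expr0n ?gtn_eqF // -exprM mulnC.
rewrite E2 (eq_bigr (fun x => w x ^+ 1)) // !wj // mulrDr.
rewrite -[X in X + _]opprK -[X in _ + X]opprK -!powsum // !powsum_bin.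
(* In the first power sum all exponents lie strictly between 0 and [8 * h]. *)
rewrite [X in - X + _]big1 ?oppr0 ?add0r; last first.
  move=> k _; have km : (k <= m)%N by rewrite -ltnS.
  rewrite sum_expr_eq0 ?mulr0 // qE gtnNdvd //; first by lia.
  by move: km; rewrite /m /h pE; nia.
(* In the fifth, [k = 3 * e + 1] is the only index whose exponent is a multiple of [8 * h]; its
   complement [m - k] is [e]. *)
have l3 : (3 * e + 1 < m.+1)%N by rewrite /m; lia.
rewrite (bigD1 (Ordinal l3)) //= [X in _ + X]big1 ?addr0.
  rewrite sum_expr_eqN1 ?qE; first last.
  - by apply/dvdnP; exists 1%N; rewrite /m /h pE; nia.
  - by rewrite addn_gt0 muln_gt0 h0 orbT.
  rewrite mulrN1 opprK -bin_sub; last by rewrite /m; lia.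
  by congr 'C(_, _)%:R; rewrite /m; lia.
move=> k; rewrite -val_eqE /= => k3; have km : (k <= m)%N by rewrite -ltnS.
rewrite sum_expr_eq0 ?mulr0 // qE; apply/negP => /dvdnP[t tE].
(* Every exponent is a multiple of [m]; after division by [m] the condition is linear in [k]. *)
have hE : h = (m * (2 * e + 1))%N by rewrite /h /m; nia.
have pm : (m - k + p * k = m * (1 + 2 * k))%N.
  have -> : p = (2 * m).+1 by rewrite pE /m; lia.
  by rewrite mulSn addnA subnK // mulnDr muln1 mulnCA mulnA.
have m0 : (0 < m)%N by rewrite /m addn1.
have : (m * (1 + 2 * k + 5 * (2 * e + 1)) = m * (t * (8 * (2 * e + 1))))%N.
  by rewrite mulnDr -pm (mulnCA m 5) -hE tE (mulnCA m t) (mulnCA m 8) -hE.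
move/eqP; rewrite eqn_pmul2l // => /eqP {}tE.
have t1 : (t <= 1)%N.
  rewrite leqNgt; apply/negP => t2; have := leq_mul t2 (leqnn (8 * (2 * e + 1))).
  by rewrite -tE; move: km; rewrite /m; lia.
by case: t t1 tE => [|[|]] // _ tE; lia.
Qed.

End EisensteinSum.

(** * Primes of the form c^2 + 2 d^2 and the final congruence *)

Lemma intr_Fermat (A : fieldType) (p : nat) (x : int) :
  p \in [pchar A] -> x%:~R != 0 :> A -> (x%:~R : A) ^+ p.-1 = 1.
Proof.
move=> cA x0; apply: (mulfI x0); rewrite -exprS prednK ?mulr1.
  by rewrite -(pFrobenius_autE cA) rmorph_int.
exact: prime_gt0 (pcharf_prime cA).
Qed.

(** In [A], -2 is the square of c / d, and Fermat's theorem applies to [c] and [d]. *)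
Lemma neg2_pow_half (A : fieldType) (p : nat) (c d : int) :
  p \in [pchar A] -> odd p -> p%:Z = c ^+ 2 + 2 * d ^+ 2 -> (-2) ^+ p./2 = 1 :> A.
Proof.
move=> cA op pE; have p2 := odd_prime_gt2 op (pcharf_prime cA).
have E : (c%:~R : A) ^+ 2 = -2 * d%:~R ^+ 2.
  have : (p%:Z)%:~R = 0 :> A by rewrite -[LHS]/(p%:R) pcharf0.
  rewrite pE rmorphD rmorphM !rmorphXn /= => /eqP.
  by rewrite addr_eq0 mulNr => /eqP.
have d0 : d%:~R != 0 :> A.
  (* If [p] divided [d], it would divide [c] too, and p^2 would divide p. *)
  apply/negP => d0; move: (d0); rewrite (eqP d0) expr0n mulr0 in E.
  move/eqP: E; rewrite expf_eq0 /= !(intr_pchar_eq0 _ cA).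
  move=> /dvdzP[c' cE] /dvdzP[d' dE]; rewrite cE dE in pE.
  have : p%:Z * (p%:Z * (c' ^+ 2 + 2 * d' ^+ 2) - 1) = 0.
    by rewrite mulrBr mulr1 [X in _ - X]pE; ring.
  move/eqP; rewrite mulf_eq0 => /orP[/eqP p0|]; first by move: p2; lia.
  rewrite subr_eq0 => /eqP p1.
  have : (p %| (1 : int)%R)%Z by rewrite -p1 dvdz_mulr.
  by rewrite dvdzE dvdn1 absz_nat => /eqP p1'; move: p2; rewrite p1'.
have n2 : 2 != 0 :> A by apply: (natr_pchar_neq0 cA).
have c0 : c%:~R != 0 :> A.
  by rewrite -sqrf_eq0 E mulf_neq0 ?oppr_eq0 // expf_neq0.
have pm : (2 * p./2 = p.-1)%N by rewrite -[p in RHS]odd_double_half op mul2n.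
have : (c%:~R ^+ 2) ^+ p./2 = (-2) ^+ p./2 * (d%:~R ^+ 2) ^+ p./2 :> A.
  by rewrite E exprMn.
by rewrite -!exprM pm !(intr_Fermat cA) // mulr1.
Qed.

Lemma franel_half_norm (p : nat) : prime p -> (p %% 8 = 1 \/ p %% 8 = 3)%N ->
  exists c d : int, p%:Z = c ^+ 2 + 2 * d ^+ 2 /\
    forall A : fieldType, p \in [pchar A] ->
      (-1) ^+ p./2 * (franel p./2)%:R = (2 * c%:~R) ^+ 2 :> A.
Proof.
move=> pp p8; have op : odd p by case: p8; lia.
(* The integers come from one particular field [K], but the equality is a divisibility by [p] and so
   passes to every [A]. *)
suff [c [d [pE [K cK K2]]]] : exists c d : int, p%:Z = c ^+ 2 + 2 * d ^+ 2 /\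
    exists2 K : fieldType, p \in [pchar K] &
      (2 * c%:~R) ^+ 2 = 'C(p./2, p %/ 8)%:R ^+ 2 :> K.
  exists c, d; split => // A cA.
  rewrite (franel_half_split cA op); last by case: p8; lia.
  rewrite mulrA -exprMn mulN1r (neg2_pow_half cA op pE) mul1r.
  have : ((2 * c) ^+ 2 - 'C(p./2, p %/ 8)%:R ^+ 2)%:~R == 0 :> K.
    by rewrite rmorphB !rmorphXn rmorphM /= !rmorph_nat K2 subrr.
  rewrite (intr_pchar_eq0 _ cK) -(intr_pchar_eq0 _ cA) rmorphB !rmorphXn rmorphM /=.
  by rewrite !rmorph_nat subr_eq0 => /eqP.
case: p8 => p8.
  have pE : p = (8 * (p %/ 8)).+1 by lia.
  have pm : p./2 = (4 * (p %/ 8))%N by rewrite -divn2; lia.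
  have [c [d [E1 E2]]] := jacobi_norm_form (pchar_Fp pp) (card_Fp pp) pE.
  exists c, d; split => //; exists 'F_p; first exact: pchar_Fp.
  by rewrite pm E2 sqrrN.
have pE : p = (8 * (p %/ 8) + 3)%N by lia.
have pm : p./2 = (4 * (p %/ 8) + 1)%N by rewrite -divn2; lia.
have [K cK oK] := pPrimePowerField pp (isT : (0 < 2)%N).
have [c [d [E1 E2]]] := eisenstein_norm_form cK oK pE.
exists c, d; split => //; exists K => //.
(* The factor [2 ^+ p./2] of the Eisenstein sum squares to 1 by Fermat. *)
rewrite pm -E2 [RHS]exprMn -exprM -pm.
have -> : (p./2 * 2 = p.-1)%N by rewrite -[p in RHS]odd_double_half op muln2.
have n2 : 2 != 0 :> K.
  by apply: (natr_pchar_neq0 cK); rewrite odd_prime_gt2.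
by rewrite -[2 ^+ p.-1]/((2 : int)%:~R ^+ p.-1) (intr_Fermat cK) ?mul1r.
Qed.

(** The power sums satisfy s_(n+2) = T s_(n+1) - P s_n, whence two consecutive indices in the
    induction. Exponents start at 1 because x^0 + y^0 = 2 differs from T^0. *)
Lemma conj_pow_sum (B : comNzRingType) (x y : B) (P T : int) :
  x + y = T%:~R -> x * y = P%:~R -> forall n : nat,
  exists2 a : int, x ^+ n.+1 + y ^+ n.+1 = a%:~R & (P %| a - T ^+ n.+1)%Z.
Proof.
move=> xyT xyP n.
suff [] : (exists2 a : int, x ^+ n.+1 + y ^+ n.+1 = a%:~R & (P %| a - T ^+ n.+1)%Z)
   /\ (exists2 a : int, x ^+ n.+2 + y ^+ n.+2 = a%:~R & (P %| a - T ^+ n.+2)%Z) by [].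
elim: n => [|n [[a aE aP] [b bE bP]]].
  split; first by exists T => //; rewrite subrr dvdz0.
  exists (T ^+ 2 - 2 * P); last by rewrite addrAC subrr add0r rpredN dvdz_mull.
  by rewrite rmorphB rmorphXn rmorphM /= -xyT -xyP; ring.
split; first by exists b.
exists (T * b - P * a).
  by rewrite rmorphB !rmorphM /= -aE -bE -xyT -xyP !exprS; ring.
rewrite [X in (_ %| X)%Z](_ : _ = T * (b - T ^+ n.+2) - P * a); last by rewrite !exprS; ring.
by apply: rpredB; [exact: dvdz_mull | exact: dvdz_mulr].
Qed.

Theorem theorem1p8 (R : realType) (g : nat -> R[i] -> R[i])
    (beta : nat -> nat -> R[i])
    (hg : forall k : nat, odd k -> (3 <= k)%N -> is_g k (g k) (beta k))
    (p r : nat) (hp : prime p) (hp2 : (2 < p)%N) (hr : (1 <= r)%N) :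
  int_congr p
    ((-1) ^+ ((p ^ r - 1) %/ 2)%N * (franel ((p ^ r - 1) %/ 2)%N)%:Z)
    (beta (2 * r + 1)%N p).
Proof.
have op : odd p by have [p2|] := even_prime hp; [rewrite p2 in hp2 | ].
have cF := pchar_Fp hp.
have X_Fp : ((-1) ^+ ((p ^ r - 1) %/ 2) * (franel ((p ^ r - 1) %/ 2))%:Z)%:~R
    = ((-1) ^+ p./2 * (franel p./2)%:R) ^+ r :> 'F_p.
  by rewrite -(franel_half_pow r cF op) rmorphM rmorphXn rmorphN1.
have ok : odd (2 * r + 1) by rewrite addn1 mul2n /= odd_double.
have k3 : (3 <= 2 * r + 1)%N by lia.
have G := hg _ ok k3.
have [ps|pi] : ((p %% 8 = 1 \/ p %% 8 = 3) \/ (p %% 8 <> 1 /\ p %% 8 <> 3))%N by lia.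
  have [c [d [pE E]]] := franel_half_norm hp ps.
  have s2 : sqrt_m2 R ^+ 2 = -2 by rewrite sqrtCK.
  have xy1 : c%:~R + d%:~R * sqrt_m2 R + (c%:~R - d%:~R * sqrt_m2 R)
      = (2 * c)%:~R by rewrite rmorphM /=; ring.
  have xy2 : (c%:~R + d%:~R * sqrt_m2 R) * (c%:~R - d%:~R * sqrt_m2 R)
      = (p%:Z)%:~R.
    transitivity (c%:~R ^+ 2 - d%:~R ^+ 2 * sqrt_m2 R ^+ 2); first by ring.
    by rewrite s2 pE rmorphD rmorphM !rmorphXn /=; ring.
  (* The trace is [2 * c] and the norm [p]; the predecessor matches the shifted exponent. *)
  have [a aE aP] := conj_pow_sum xy1 xy2 (2 * r).-1.
  have r2 : ((2 * r).-1.+1 = 2 * r)%N by lia.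
  rewrite r2 in aE aP; exists a.
    by rewrite (g_split G hp ps pE) addnK aE.
  apply/eqP; rewrite eqz_mod_dvd -(intr_pchar_eq0 _ cF) rmorphB subr_eq0 /=.
  rewrite X_Fp (E _ cF) -exprM.
  move: aP; rewrite -(intr_pchar_eq0 _ cF) rmorphB subr_eq0 /= => /eqP ->.
  by rewrite rmorphXn rmorphM.
exists 0; first by rewrite (g_inert G) //; lia.
apply/eqP; rewrite eqz_mod_dvd subr0 -(intr_pchar_eq0 _ cF) X_Fp.
(* For [p] = 5 or 7 mod 8, [p %/ 4] is odd; [0 ^+ r] vanishes because [r] is positive. *)
by rewrite (franel_half_inert cF op) ?mulr0 ?expr0n ?gtn_eqF //; lia.
Qed.
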